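(* For every constant $\varepsilon\in(0,\sqrt{2/\pi}]$, let $$\gamma(\varepsilon)=\limsup_{T\to\infty}\frac{1}{\sqrt T}\inf_{\mathrm{alg}}\Big\{\sup_{\mathrm{adv}}\mathrm{Regret}^{\mathrm{unif}}_T(\mathrm{alg},\mathrm{adv})\ :\ \sup_{\mathrm{adv}}\mathrm{Loss}_T(\mathrm{alg},\mathrm{adv})\le\varepsilon\sqrt T\Big\},$$ where the infimum is over OLO algorithms satisfying the stated constraint and the suprema are over adversaries with $g_t\in[-1,1]$ for all $t$. Then $\gamma(\varepsilon)$ is the unique solution of the equation $$\int_{-\infty}^{\varepsilon-\gamma(\varepsilon)}\Phi(x)\,dx=\frac{\varepsilon}{2},$$ where $\Phi$ is the standard normal CDF. Furthermore, for every integer $T\ge1$ there exists a special case of the Stein algorithm (i.e. a choice of convex $1$-Lipschitz input $h$ and of admissible parameters $\rho_0,\dots,\rho_T$) that, against every adversary with $g_t\in[-1,1]$ for all $t$, simultaneously guarantees $\mathrm{Loss}_T\le\varepsilon\sqrt T+O(\log T)$ and $\mathrm{Regret}^{\mathrm{unif}}_T\le\gamma(\varepsilon)\sqrt T+O(\log T)$, where $O(\log T)$ denotes a term bounded by $C(1+\log T)$ for an absolute constant $C$.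
   Context: Online linear optimization (OLO) game with horizon $T$: an OLO algorithm $\mathrm{alg}$ is a sequence of functions $a_t:\mathbb{R}^{t-1}\to[-1,1]$, $t=1,\dots,T$ (which may depend on $T$), and an adversary $\mathrm{adv}$ is a sequence of functions $l_t:\mathbb{R}^{t}\to\mathbb{R}$ (which may depend on $T$ and on the algorithm). In round $t$ the algorithm plays $x_t=a_t(g_1,\dots,g_{t-1})$, then the adversary plays $g_t=l_t(x_1,\dots,x_t)$. Define $\mathrm{Loss}_T(\mathrm{alg},\mathrm{adv})=\sum_{t=1}^Tg_tx_t$ and $\mathrm{Regret}^{\mathrm{unif}}_T(\mathrm{alg},\mathrm{adv})=\sup_{u\in[-1,1]}\sum_{t=1}^Tg_t(x_t-u)$. Stein equation solution: for a $1$-Lipschitz $h:\mathbb{R}\to\mathbb{R}$, $\mu\in\mathbb{R}$, $\sigma>0$, let $f_{\mu,\sigma,h}:\mathbb{R}\to\mathbb{R}$ be the unique bounded solution of $\sigma^2f'(x)-(x-\mu)f(x)=h(x)-\mathbb{E}_{Z\sim\mathcal{N}(0,1)}[h(\mu+\sigma Z)]$ for all $x\in\mathbb{R}$. Stein algorithm with convex $1$-Lipschitz input $h$: set $s_0=0$ and choose $\rho_0>0$. In round $t$, choose (possibly depending on $g_1,\dots,g_{t-1}$) some $\rho_t\in[0,\rho_{t-1}]$, with $\rho_t>0$ required if $t<T$ (such choices are called admissible); output $x_t=\mathbb{E}_{Z\sim\mathcal{N}(0,1)}[f_{s_{t-1},\rho_{t-1},h}(s_{t-1}+\rho_tZ)]$;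 observe $g_t$ and set $s_t=s_{t-1}+g_t$. *)

(* Defs.v *)
From HB Require Import structures.
From mathcomp Require Import all_boot all_order all_algebra.
From mathcomp Require Import all_classical all_reals all_analysis.
Set Implicit Arguments.
Unset Strict Implicit.
Unset Printing Implicit Defensive.
Import Order.TTheory GRing.Theory Num.Theory.
Import numFieldNormedType.Exports.
Local Open Scope classical_set_scope.
Local Open Scope ring_scope.

Section OnlineLinearOptimization.
Context {R : realType}.

(* A family (a_t : R^(t-1) -> R)_t is encoded as one function on sequences:
   a_t is its restriction to sequences of size t-1 (and l_t, for an adversary,
   the restriction to sequences of size t).  Histories are listed oldest first
   and only sizes relevant to the horizon T matter. *)
Definition is_olo_alg (T : nat) (alg : seq R -> R) : Prop :=
  forall gs : seq R, (size gs < T)%N -> -1 <= alg gs <= 1.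

(* The pairs (x_1, g_1), ..., (x_t, g_t). *)
Fixpoint play (alg adv : seq R -> R) (t : nat) : seq (R * R) :=
  if t is t'.+1 then
    let p := play alg adv t' in
    let x := alg (unzip2 p) in
    rcons p (x, adv (rcons (unzip1 p) x))
  else [::].

Definition bounded_adv (T : nat) (alg adv : seq R -> R) : Prop :=
  forall p : R * R, p \in play alg adv T -> -1 <= p.2 <= 1.

Definition Loss (T : nat) (alg adv : seq R -> R) : R :=
  \sum_(p <- play alg adv T) p.2 * p.1.

Definition Regret_unif (T : nat) (alg adv : seq R -> R) : R :=
  sup [set \sum_(p <- play alg adv T) p.2 * (p.1 - u) | u in `[-1, 1]].

Definition worst_Loss (T : nat) (alg : seq R -> R) : \bar R :=
  ereal_sup [set (Loss T alg adv)%:E | adv in bounded_adv T alg].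

Definition worst_Regret_unif (T : nat) (alg : seq R -> R) : \bar R :=
  ereal_sup [set (Regret_unif T alg adv)%:E | adv in bounded_adv T alg].

Definition opt_Regret_unif (eps : R) (T : nat) : \bar R :=
  ereal_inf [set worst_Regret_unif T alg | alg in
    [set alg | is_olo_alg T alg /\
               (worst_Loss T alg <= (eps * Num.sqrt T%:R)%:E)%E]].

Definition gamma (eps : R) : \bar R :=
  limn_esup (fun T => ((Num.sqrt T%:R)^-1%:E * opt_Regret_unif eps T)%E).

(* E[phi(Z)] for Z ~ N(0,1). *)
Definition gaussE (phi : R -> R) : R := fine 'E_(normal_prob 0 1)[phi].

Definition is_stein_sol (mu sigma : R) (h f : R -> R) : Prop :=
  bounded_fun f /\
  forall x : R, derivable f x 1 /\
    sigma ^+ 2 * derive1 f x - (x - mu) * f x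
      = h x - gaussE (fun z => h (mu + sigma * z)).

(* For sigma > 0 and h 1-Lipschitz, the Stein equation has exactly one bounded
   solution, which is therefore the function picked here; the default value 0
   is then irrelevant. *)
Definition stein_sol (mu sigma : R) (h : R -> R) : R -> R :=
  xget (fun=> 0) [set f | is_stein_sol mu sigma h f].

(* rho_t along the history gs = (g_1, ..., g_(t-1), ...): the constant rho0 for
   t = 0, and rho (g_1, ..., g_(t-1)) for t >= 1. *)
Definition rho_at (rho0 : R) (rho : seq R -> R) (t : nat) (gs : seq R) : R :=
  if t is t'.+1 then rho (take t' gs) else rho0.

(* In round t the available history gs has size t - 1. *)
Definition admissible (T : nat) (rho0 : R) (rho : seq R -> R) : Prop :=
  0 < rho0 /\
  forall (t : nat) (gs : seq R), (1 <= t <= T)%N -> size gs = t.-1 ->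
    0 <= rho_at rho0 rho t gs <= rho_at rho0 rho t.-1 gs /\
    ((t < T)%N -> 0 < rho_at rho0 rho t gs).

Definition stein_alg (h : R -> R) (rho0 : R) (rho : seq R -> R)
    (gs : seq R) : R :=
  let t := (size gs).+1 in
  let s := \sum_(g <- gs) g in
  gaussE (fun z => stein_sol s (rho_at rho0 rho t.-1 gs) h
                     (s + rho_at rho0 rho t gs * z)).

Definition std_normal_cdf (x : R) : \bar R :=
  normal_prob 0 1 `]-oo, x].

Definition gamma_equation (eps c : R) : Prop :=
  (\int[lebesgue_measure]_(x in `]-oo, (eps - c)%R]) std_normal_cdf x
     = (eps / 2)%:E)%E.

End OnlineLinearOptimization.

(* Main.v *)
(* Upper bound.  Run the Stein algorithm on the convex potential
   h(s) = (s - a)_+ + (-s - a)_+ - A with variances T + 1, T, ..., 1.  Stein's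
   identity shows that its move is minus the slope of the heat flow
   u(s, v) = E h(s + sqrt v Z), up to O(1 / v), and a second-order expansion gives
   g x + u(s + g, v) <= u(s, v + 1) + O(1 / v) for |g| <= 1.  Summing, the loss is
   at most u(0, T + 1) - h(s_T) plus a harmonic sum O(log T).  With a = b sqrt T
   and A = 2 psi(- b) sqrt T, where psi(y) = E (y + Z)_+ is the integral of the
   normal distribution function, u(0, T) vanishes; hence the loss is at most
   2 psi(- b) sqrt T and the regret, which is the loss plus |s_T|, is at most
   (b + 2 psi(- b)) sqrt T, up to O(log T).

   Lower bound.  For g = 1 and g = -1 the expansion is two-sided, and averaging
   over the two signs removes the slope.  So whatever x is, one sign keeps loss
   plus potential from decreasing by more than O(1 / v), and this deterministic
   adversary matches the upper bound. *)
Require Import Defs.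
From HB Require Import structures.
From mathcomp Require Import all_boot all_order all_algebra.
From mathcomp Require Import all_classical all_reals all_analysis measurable_realfun.
From mathcomp Require Import ring lra.
Import Order.TTheory GRing.Theory Num.Theory.
Import numFieldNormedType.Exports.
Local Open Scope classical_set_scope.
Local Open Scope ring_scope.

(** * Derivatives, mean values and limits of real functions *)

Section RealFunctions.
Context {R : realType}.
Implicit Types (f g : R -> R) (x : R).

Lemma is_derive_fun_cst (c x : R) : is_derive x 1 (fun=> c) 0.
Proof. exact: is_derive_cst. Qed.

Lemma is_derive_fun_add f g x (a b : R) : is_derive x 1 f a ->
  is_derive x 1 g b -> is_derive x 1 (fun y => f y + g y) (a + b).
Proof. by move=> fa gb; exact: is_deriveD. Qed.

Lemma is_derive_fun_opp f x (a : R) : is_derive x 1 f a ->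
  is_derive x 1 (fun y => - f y) (- a).
Proof. by move=> fa; exact: is_deriveN. Qed.

Lemma is_derive_fun_mul f g x (a b : R) : is_derive x 1 f a ->
  is_derive x 1 g b -> is_derive x 1 (fun y => f y * g y) (f x * b + g x * a).
Proof. by move=> fa gb; exact: is_deriveM. Qed.

Lemma is_derive_fun_inv f x (a : R) : is_derive x 1 f a -> f x != 0 ->
  is_derive x 1 (fun y => (f y)^-1) (- (f x ^- 2 * a)).
Proof.
move=> fa fx; apply: is_derive_eq (is_deriveV fx fa) _.
by rewrite /GRing.scale/= mulNr.
Qed.

Lemma is_derive_fun_comp f g x (a b : R) : is_derive (g x) 1 f a ->
  is_derive x 1 g b -> is_derive x 1 (fun y => f (g y)) (a * b).
Proof. by move=> fa gb; exact: is_derive1_comp. Qed.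

Lemma is_derive_cvg f x (a : R) : is_derive x 1 f a -> f y @[y --> x] --> f x.
Proof. by move=> fa; exact/differentiable_continuous/derivable1_diffP. Qed.

Lemma derivable_continuous f (df : R -> R) :
  (forall x, is_derive x 1 f (df x)) -> continuous f.
Proof. by move=> fd x; exact: (is_derive_cvg _ _ _ (fd x)). Qed.

(** The intermediate point is located by [min] and [max], so that [a] and [b] may come in either
    order. *)
Lemma mean_value f (df : R -> R) (a b : R) :
    (forall x, is_derive x 1 f (df x)) ->
  exists2 c, Num.min a b <= c <= Num.max a b & f b - f a = df c * (b - a).
Proof.
move=> fd; have cf := derivable_continuous _ _ fd.
have [ab|ba] := leP a b.
  have [|c + E] := MVT_segment ab (fun x _ => fd x).
    exact: continuous_subspaceT.
  by rewrite in_itv/= => H; exists c.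
have [|c + E] := MVT_segment (ltW ba) (fun x _ => fd x).
  exact: continuous_subspaceT.
rewrite in_itv/= => H; exists c => //.
by rewrite -opprB E -mulrN opprB.
Qed.

Lemma derive_ge0_homo f (df : R -> R) :
    (forall x, is_derive x 1 f (df x)) -> (forall x, 0 <= df x) ->
  {homo f : x y / x <= y}.
Proof.
move=> fd df0 a b ab; have [c _ E] := mean_value _ _ a b fd.
by rewrite -subr_ge0 E mulr_ge0// subr_ge0.
Qed.

(** Serves to derive Gaussian tail inequalities from the sign of a derivative and a limit at minus
    infinity. *)
Lemma homo_cvgNy_ge f (l : R) (a : R) :
  (forall x y, x <= y -> y <= a -> f x <= f y) ->
  f x @[x --> -oo] --> l -> l <= f a.
Proof.
move=> fh fl; apply: (cvgr_to_le fl).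
near=> x; apply: fh => //; near: x; apply: nbhs_ninfty_le; exact: num_real.
Unshelve. all: by end_near. Qed.

Lemma cvgNy0_norm_le f (C : R) :
  (forall x, x <= -1 -> `|f x| <= C / `|x|) -> f x @[x --> -oo] --> (0 : R).
Proof.
move=> fC; apply/cvgrPdist_le => e e0.
near=> x.
have x1 : x <= -1 by near: x; apply: nbhs_ninfty_le; exact: num_real.
rewrite sub0r normrN (le_trans (fC _ x1))// ltr0_norm; last lra.
rewrite ler_pdivrMr; last lra.
have : x <= - (C / e) by near: x; apply: nbhs_ninfty_le; exact: num_real.
rewrite lerNr ler_pdivrMr// => H; by rewrite mulrC.
Unshelve. all: by end_near. Qed.

End RealFunctions.

(* [is_derive] is a class: plain [refine] would discharge the premises with the
   library instances, whose derivatives are stated with [*:]. *)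
Ltac isder_with tac := lazymatch goal with
 | |- is_derive _ _ (fun y => y) _ => exact: is_derive_id
 | |- is_derive _ _ (fun=> ?c) _ => exact: is_derive_fun_cst
 | |- is_derive _ _ (fun y => (@?f y + @?g y)%R) _ =>
     notypeclasses refine (is_derive_fun_add f g _ _ _ _ _); isder_with tac
 | |- is_derive _ _ (fun y => (- @?f y)%R) _ =>
     notypeclasses refine (is_derive_fun_opp f _ _ _); isder_with tac
 | |- is_derive _ _ (fun y => (@?f y * @?g y)%R) _ =>
     notypeclasses refine (is_derive_fun_mul f g _ _ _ _ _); isder_with tac
 | |- is_derive _ _ (fun y => ((@?f y)^-1)%R) _ =>
     notypeclasses refine (is_derive_fun_inv f _ _ _ _); [isder_with tac|]
 | |- is_derive _ _ (fun y => ?f (@?g y)) _ =>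
     notypeclasses refine (is_derive_fun_comp f g _ _ _ _ _); [tac|isder_with tac]
 | |- is_derive _ _ ?f _ => tac
 end.

Ltac isder_eq tac :=
  notypeclasses refine (is_derive_eq _ _); [isder_with tac|cbv beta].

(** * The normal density and distribution function *)

Section Gaussian.
Context {R : realType}.
Implicit Types x y : R.

Definition gpdf (x : R) : R := normal_pdf 0 1 x.
Definition gcdf (x : R) : R := fine (normal_prob 0 1 `]-oo, x]).
(* E (x + Z)_+, a primitive of the distribution function. *)
Definition gcdf_int (x : R) : R := x * gcdf x + gpdf x.

Let gpdf_expE x : gpdf x = normal_peak 1 * expR (- (x - 0) ^+ 2 / (1 ^+ 2 *+ 2)).
Proof. by rewrite /gpdf normal_pdfE ?oner_eq0. Qed.

Lemma gpdf_gt0 x : 0 < gpdf x.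
Proof. by rewrite gpdf_expE mulr_gt0 ?expR_gt0 ?normal_peak_gt0 ?oner_eq0. Qed.

Lemma gpdfE x : gpdf x = gpdf 0 * expR (- (x * x / 2)).
Proof.
rewrite !gpdf_expE -[RHS]mulrA -expRD; congr (_ * expR _).
by rewrite !subr0 !expr2; field.
Qed.

Lemma gpdf0 : gpdf 0 = (Num.sqrt (2 * pi))^-1.
Proof.
rewrite gpdf_expE /normal_peak.
by rewrite subr0 expr0n/= oppr0 mul0r expR0 mulr1 expr1n mul1r mulr_natl.
Qed.

Lemma gpdfN x : gpdf (- x) = gpdf x.
Proof. by rewrite gpdfE [RHS]gpdfE mulrNN. Qed.

Lemma gpdf0_le1 : gpdf 0 <= 1.
Proof.
rewrite gpdf0 invf_le1; last by rewrite sqrtr_gt0 mulr_gt0 ?pi_gt0.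
rewrite -[leLHS]sqrtr1 ler_sqrt; last by rewrite mulr_ge0 ?pi_ge0.
by have := @pi_ge2 R; lra.
Qed.

Lemma is_derive_gpdf x : is_derive x 1 gpdf (- x * gpdf x).
Proof.
have -> : gpdf = (fun y => gpdf 0 * expR (- (y * y * 2^-1))).
  by apply/funext => y; exact: gpdfE.
isder_eq ltac:(exact: is_derive_expR).
by rewrite /=; field.
Qed.

Lemma continuous_gpdf : continuous gpdf.
Proof. exact: derivable_continuous is_derive_gpdf. Qed.

Lemma gcdfE x : normal_prob 0 1 `]-oo, x] = (gcdf x)%:E.
Proof. by rewrite /gcdf fineK// fin_num_measure. Qed.

Lemma is_derive_gcdf x : is_derive x 1 gcdf (gpdf x).
Proof.
have := @continuous_FTC1 R gpdf -oo%O x (x + 1).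
case.
- lra.
- apply: (integrableS _ _ (@subsetT _ _)) => //.
  exact: integrable_normal_pdf.
- by rewrite ltNyr.
- exact: continuous_gpdf.
by move=> d <-; rewrite derive1E; exact: derivableP.
Qed.

Lemma gcdf_ge0 x : 0 <= gcdf x.
Proof. exact: fine_ge0. Qed.

Lemma gcdf_le1 x : gcdf x <= 1.
Proof. by rewrite -lee_fin -gcdfE probability_le1. Qed.

(** Under the normal law the identity is a random variable with distribution function [gcdf], so the
    limits of a cdf at both infinities apply. *)
Let idTR : measurableTypeR R -> R := idfun.
#[local] HB.instance Definition _ :=
  @isMeasurableFun.Build _ _ _ _ idTR (@measurable_id _ _ setT).

Lemma gcdf_cvgNy : gcdf x @[x --> -oo] --> (0 : R).
Proof.
apply: fine_cvg; exact: (cvg_cdfNy0 (idTR : {RV (normal_prob 0 1) >-> R})).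
Qed.

Lemma gcdf_cvgy : gcdf x @[x --> +oo] --> (1 : R).
Proof.
apply: fine_cvg; exact: (cvg_cdfy1 (idTR : {RV (normal_prob 0 1) >-> R})).
Qed.

(** The density is even, so [gcdf y + gcdf (- y)] has derivative zero; its constant value is its
    limit at infinity. *)
Lemma gcdfN x : gcdf (- x) = 1 - gcdf x.
Proof.
have d y : is_derive y 1 (fun y => gcdf y + gcdf (- y)) 0.
  isder_eq ltac:(exact: is_derive_gcdf).
  by rewrite gpdfN; ring.
suff E : 1 + 0 = gcdf x + gcdf (- x) by lra.
apply: (@cvg_unique _ _ (gcdf y + gcdf (- y) @[y --> +oo])) => //.
  apply: cvgD; first exact: gcdf_cvgy.
  exact: ((cvgNy_compNP gcdf (nbhs (0 : R))).1 gcdf_cvgNy).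
apply: cvg_near_cst; apply: nearW => y.
exact: (is_derive_0_is_cst y x d).
Qed.

Lemma is_derive_gcdf_int x : is_derive x 1 gcdf_int (gcdf x).
Proof.
rewrite /gcdf_int.
isder_eq ltac:(first [exact: is_derive_gcdf|exact: is_derive_gpdf]).
by ring.
Qed.

Lemma gcdf_int_sub x : gcdf_int x - gcdf_int (- x) = x.
Proof. by rewrite /gcdf_int gcdfN gpdfN; ring. Qed.

End Gaussian.

Ltac isder := isder_eq ltac:(first [exact: is_derive_gcdf | exact: is_derive_gpdf
  | exact: is_derive_gcdf_int | exact: is_derive_expR]).

(** * Tail bounds, limits and convexity for the normal distribution *)

Section GaussianEstimates.
Context {R : realType}.
Implicit Types x y : R.

Let expRN_mul_le (y : R) : 0 <= y -> y * expR (- y) <= 1.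
Proof.
move=> y0; rewrite expRN ler_pdivrMr ?expR_gt0// mul1r.
by have := @expR_ge1Dx R y; lra.
Qed.

Lemma sqr_gpdf_le x : x * x * gpdf x <= 2.
Proof.
have x0 : 0 <= x * x by rewrite -expr2 sqr_ge0.
have H : x * x / 2 * expR (- (x * x / 2)) <= 1 by apply: expRN_mul_le; lra.
have e0 := expR_gt0 (- (x * x / 2)).
have -> : x * x * gpdf x = gpdf 0 * (2 * (x * x / 2 * expR (- (x * x / 2)))).
  by rewrite gpdfE; field.
have : 0 <= x * x / 2 * expR (- (x * x / 2)).
  by rewrite mulr_ge0 ?(ltW e0)//; lra.
move: H; have := @gpdf0_le1 R; have := @gpdf_gt0 R 0.
by move: (_ * expR _) (gpdf 0) => u g g0 g1 u1 u0; nra.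
Qed.

(** The bound [u * expR (- u) <= 1] at [u = x * x / 4], squared: the exponential in the density
    splits into two equal factors. *)
Lemma quartic_gpdf_le x : x * x * (x * x) * gpdf x <= 16.
Proof.
have x0 : 0 <= x * x by rewrite -expr2 sqr_ge0.
have H : x * x / 4 * expR (- (x * x / 4)) <= 1 by apply: expRN_mul_le; lra.
have e0 := expR_gt0 (- (x * x / 4)).
have -> : gpdf x = gpdf 0 * (expR (- (x * x / 4)) * expR (- (x * x / 4))).
  by rewrite gpdfE -expRD; congr (_ * expR _); field.
have := @gpdf0_le1 R; have := @gpdf_gt0 R 0.
set e := expR _ in H e0 *; set g := gpdf 0.
move=> g0 g1; set t := x * x / 4 * e in H.
have t0 : 0 <= t by apply: mulr_ge0; [lra|exact: ltW].
have -> : x * x * (x * x) * (g * (e * e)) = 16 * (g * (t * t)).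
  by rewrite /t; field.
nra.
Qed.

Lemma gpdf_le1 x : gpdf x <= 1.
Proof.
rewrite gpdfE; have := @gpdf0_le1 R; have := @gpdf_gt0 R 0.
have : expR (- (x * x / 2)) <= 1.
  by rewrite expR_le1; have := sqr_ge0 x; rewrite expr2; lra.
have := expR_gt0 (- (x * x / 2)); move: (expR _) (gpdf 0) => e g.
by move=> *; nra.
Qed.

Lemma norm_gpdf_le x : `|x| * gpdf x <= 2.
Proof.
have := sqr_gpdf_le x; have := @gpdf_gt0 R x.
have gx1 := gpdf_le1 x.
have -> : x * x = `|x| * `|x| by rewrite -!expr2 -normrX ger0_norm ?sqr_ge0.
move: (normr_ge0 x); set a := `|x|; set g := gpdf x in gx1 *.
by move=> *; nra.
Qed.

Let sqr_gpdf_decay x : x <= -1 -> x * x * gpdf x <= 16 / `|x|.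
Proof.
move=> x1; have := quartic_gpdf_le x; have := @gpdf_gt0 R x.
rewrite ltr0_norm; last lra.
rewrite ler_pdivlMr; last lra.
set g := gpdf x => g0 *; nra.
Qed.

Lemma gpdf_cvgNy : gpdf x @[x --> -oo] --> (0 : R).
Proof.
apply: (@cvgNy0_norm_le _ _ 16) => x x1.
apply: le_trans (sqr_gpdf_decay _ x1).
have g0 := @gpdf_gt0 R x; rewrite gtr0_norm//.
have x2 : 1 <= x * x by nra.
by rewrite ler_peMl// ltW.
Qed.

(** The difference [gpdf - gcdf] vanishes at minus infinity, and its derivative [(- y - 1) * gpdf y]
    is nonnegative up to -1. *)
Lemma gcdf_le_gpdf x : x <= -1 -> gcdf x <= gpdf x.
Proof.
move=> x1; rewrite -subr_ge0.
have d y : is_derive y 1 (fun y => gpdf y - gcdf y) ((- y - 1) * gpdf y).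
  by isder; ring.
apply: (@homo_cvgNy_ge _ (fun y => gpdf y - gcdf y)); last first.
  rewrite -[X in _ --> X]subr0; apply: (@cvgB _ R^o); [exact: gpdf_cvgNy|exact: gcdf_cvgNy].
move=> a b ab bx; have [c /andP[_ cb] E] := mean_value _ _ a b d.
rewrite -subr_ge0 /= E; rewrite (max_idPr ab) in cb.
have gc := @gpdf_gt0 R c.
apply: mulr_ge0; last by rewrite subr_ge0.
by apply: mulr_ge0; [lra|exact: ltW].
Qed.

Let gcdf_decay x : x <= -1 -> x * x * gcdf x <= 16 / `|x|.
Proof.
move=> x1; apply: le_trans (sqr_gpdf_decay _ x1).
by rewrite ler_wpM2l ?gcdf_le_gpdf// -expr2 sqr_ge0.
Qed.

Lemma mul_gcdf_cvgNy : x * gcdf x @[x --> -oo] --> (0 : R).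
Proof.
apply: (@cvgNy0_norm_le _ _ 16) => x x1.
apply: le_trans (gcdf_decay _ x1).
have g0 := @gcdf_ge0 R x; rewrite normrM (ger0_norm g0) ltr0_norm; last lra.
by apply: ler_wpM2r => //; nra.
Qed.

Lemma gcdf_int_cvgNy : gcdf_int x @[x --> -oo] --> (0 : R).
Proof.
rewrite -[X in _ --> X]addr0.
by apply: cvgD; [exact: mul_gcdf_cvgNy|exact: gpdf_cvgNy].
Qed.

Lemma gcdf_gt0 x : 0 < gcdf x.
Proof.
have [c _ E] := mean_value _ _ (x - 1) x (@is_derive_gcdf R).
have := @gcdf_ge0 R (x - 1); have := @gpdf_gt0 R c.
by move: E; rewrite opprB subrKC mulr1 => /eqP; rewrite subr_eq => /eqP ->; lra.
Qed.

Lemma gcdf_int_gt0 x : 0 < gcdf_int x.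
Proof.
have g0 : 0 <= gcdf_int (x - 1).
  apply: homo_cvgNy_ge gcdf_int_cvgNy => a b ab _.
  by apply: derive_ge0_homo ab; [exact: is_derive_gcdf_int|exact: gcdf_ge0].
have [c _ E] := mean_value _ _ (x - 1) x (@is_derive_gcdf_int R).
have := gcdf_gt0 c.
by move: E; rewrite opprB subrKC mulr1 => /eqP; rewrite subr_eq => /eqP ->; lra.
Qed.

Lemma gcdf_int_lt x y : x < y -> gcdf_int x < gcdf_int y.
Proof.
move=> xy; have [c _ E] := mean_value _ _ x y (@is_derive_gcdf_int R).
by rewrite -subr_gt0 E mulr_gt0 ?gcdf_gt0// subr_gt0.
Qed.

Lemma gcdf_le x y : x <= y -> gcdf x <= gcdf y.
Proof.
move: x y; apply: derive_ge0_homo; first exact: is_derive_gcdf.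
by move=> x; exact/ltW/gpdf_gt0.
Qed.

(** Convexity of [gcdf_int], whose derivative [gcdf] is nondecreasing. *)
Lemma gcdf_int_tangent x y : gcdf_int x + gcdf x * (y - x) <= gcdf_int y.
Proof.
have [c + E] := mean_value _ _ x y (@is_derive_gcdf_int R).
rewrite -lerBrDl E; case: (leP x y) => xy /andP[xc cy].
  by rewrite ler_wpM2r ?gcdf_le// subr_ge0.
by rewrite ler_wnM2r ?gcdf_le// subr_le0 ltW.
Qed.

Lemma gcdf_int_ge_pos x : Num.max x 0 <= gcdf_int x.
Proof.
rewrite ge_max (ltW (gcdf_int_gt0 x)) andbT.
by have := @gcdf_int_sub R x; have := gcdf_int_gt0 (- x); lra.
Qed.

Lemma gcdf_int_le_pos x : gcdf_int x <= Num.max x 0 + gcdf_int 0.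
Proof.
have := gcdf_int_tangent x 0; have := @gcdf_le1 R x; have := @gcdf_ge0 R x.
have [x0|x0] := leP x 0; last by nra.
move=> _ _ _; rewrite add0r; case: ltgtP x0 => // [x0 _|-> //].
exact/ltW/gcdf_int_lt.
Qed.

(** Expanded, this is the classical Mills ratio bound [(1 + x ^+ 2) * gcdf x + x * gpdf x >= 0]. The
    left side vanishes at minus infinity and has derivative [2 * gcdf_int]. *)
Lemma gcdf_add_mul_gcdf_int_ge0 x : 0 <= gcdf x + x * gcdf_int x.
Proof.
have d y : is_derive y 1 (fun y => gcdf y + y * gcdf_int y) (2 * gcdf_int y).
  by isder; rewrite /gcdf_int; ring.
apply: (@homo_cvgNy_ge _ (fun y => gcdf y + y * gcdf_int y)).
  move=> a b ab _; apply: derive_ge0_homo ab => // z.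
  by rewrite mulr_ge0// ltW ?gcdf_int_gt0.
rewrite -[X in _ --> X]addr0; apply: cvgD; first exact: gcdf_cvgNy.
apply: (@cvgNy0_norm_le _ _ 32) => y y1.
rewrite /gcdf_int mulrDr mulrA (le_trans (ler_normD _ _))//.
have -> : 32 / `|y| = 16 / `|y| + 16 / `|y| by rewrite -mulrDl; congr (_ / _); ring.
apply: lerD.
  rewrite normrM (ger0_norm (gcdf_ge0 y)) ger0_norm ?gcdf_decay//.
  by rewrite -expr2 sqr_ge0.
apply: le_trans (sqr_gpdf_decay _ y1); have g0 := @gpdf_gt0 R y.
rewrite normrM (gtr0_norm g0) ltr0_norm; last lra.
by apply: ler_wpM2r; [exact: ltW|nra].
Qed.

End GaussianEstimates.

(** * The Stein equation for a hinge *)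

Section SteinHinge.
Context {R : realType}.
Implicit Types a x y : R.

(** In Carathéodory's form a derivative is the value at [a] of a slope function continuous there.
    Both slope functions take the value [fa] at [a], so the glued one is continuous too. *)
Lemma is_derive_glue (f g : R -> R) (a fa : R) :
    f a = g a -> is_derive a 1 f fa -> is_derive a 1 g fa ->
  is_derive a 1 (fun y => if y <= a then f y else g y) fa.
Proof.
move=> fga /is_derive1_caratheodory[u [fu cu ua]].
move=> /is_derive1_caratheodory[v [gv cv va]].
apply/is_derive1_caratheodory.
exists (fun y => if y <= a then u y else v y); split.
- by move=> z; rewrite lexx; case: ifP => _; [exact: fu|rewrite fga; exact: gv].
- rewrite /prop_for /continuous_at /= lexx; apply/cvgrPdist_lt => e e0.
  have /cvgrPdist_lt/(_ e e0) Hu : u y @[y --> a] --> u a := cu.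
  have /cvgrPdist_lt/(_ e e0) Hv : v y @[y --> a] --> v a := cv.
  near=> y; case: ifP => _.
    by near: y; exact: Hu.
  by rewrite ua -va; near: y; exact: Hv.
- by rewrite lexx.
Unshelve. all: by end_near. Qed.

(* Both pieces of [stein_hinge] are multiples of this ratio. *)
Definition mills x := gcdf x / gpdf x.
Definition dmills x := gcdf_int x / gpdf x.

Lemma is_derive_mills x : is_derive x 1 mills (dmills x).
Proof.
rewrite /mills; isder; first by rewrite gt_eqF ?gpdf_gt0.
rewrite /dmills /gcdf_int; field.
by rewrite gt_eqF ?gpdf_gt0.
Qed.

(** This linear equation is what makes multiples of [mills] solve the Stein equation on each side of
    the kink. *)
Lemma dmillsE x : dmills x = 1 + x * mills x.
Proof.
rewrite /mills /dmills /gcdf_int; field.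
by rewrite gt_eqF ?gpdf_gt0.
Qed.

Lemma mills_gt0 x : 0 < mills x.
Proof. by rewrite divr_gt0 ?gcdf_gt0 ?gpdf_gt0. Qed.

Lemma dmills_gt0 x : 0 < dmills x.
Proof. by rewrite divr_gt0 ?gcdf_int_gt0 ?gpdf_gt0. Qed.

Lemma mills_le x y : x <= y -> mills x <= mills y.
Proof.
move: x y; apply: derive_ge0_homo; first exact: is_derive_mills.
by move=> x; exact/ltW/dmills_gt0.
Qed.

(** Convexity of [mills]: the numerator of its second derivative is the quantity of
    [gcdf_add_mul_gcdf_int_ge0]. *)
Lemma dmills_le x y : x <= y -> dmills x <= dmills y.
Proof.
pose d x := (gcdf x + x * gcdf_int x) / gpdf x : R.
move: x y; apply: (@derive_ge0_homo _ _ d) => x; last first.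
  by rewrite divr_ge0 ?gcdf_add_mul_gcdf_int_ge0// ltW ?gpdf_gt0.
rewrite /dmills; isder; first by rewrite gt_eqF ?gpdf_gt0.
by rewrite /d; field; rewrite gt_eqF ?gpdf_gt0.
Qed.

(** The left side is the Wronskian of [gcdf_int (- x)] and [gcdf_int x]. It makes the two pieces of
    [stein_hinge] meet at the kink and bounds them there. *)
Lemma gcdf_int_wronskian a :
  gcdf_int a * gcdf (- a) + gcdf_int (- a) * gcdf a = gpdf a.
Proof. by rewrite /gcdf_int gpdfN gcdfN; ring. Qed.

(* The bounded solution of f' - x f = (x - a)_+ - E (Z - a)_+. *)
Definition stein_hinge a x :=
  if x <= a then - gcdf_int (- a) * mills x
  else - 1 + gcdf_int a * mills (- x).

Let stein_hinge_match a :
  - gcdf_int (- a) * mills a = - 1 + gcdf_int a * mills (- a).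
Proof.
have g0 := @gpdf_gt0 R a.
rewrite /mills gpdfN.
have -> : gcdf_int a * (gcdf (- a) / gpdf a)
    = (gpdf a - gcdf_int (- a) * gcdf a) / gpdf a.
  by rewrite -[X in X - _]gcdf_int_wronskian addrK mulrA.
by field; rewrite gt_eqF.
Qed.

(** Each piece solves the equation on the whole line for its own branch of the hinge, 0 or [x - a].
    These branches agree at [a], hence so do the one-sided derivatives. *)
Lemma is_derive_stein_hinge a x : is_derive x 1 (stein_hinge a)
  (x * stein_hinge a x + Num.max (x - a) 0 - gcdf_int (- a)).
Proof.
have dl y : is_derive y 1 (fun y => - gcdf_int (- a) * mills y)
    (y * (- gcdf_int (- a) * mills y) - gcdf_int (- a)).
  isder_eq ltac:(exact: is_derive_mills).
  by rewrite dmillsE; ring.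
have dr y : is_derive y 1 (fun y => - 1 + gcdf_int a * mills (- y))
    (y * (- 1 + gcdf_int a * mills (- y)) + (y - a) - gcdf_int (- a)).
  isder_eq ltac:(exact: is_derive_mills).
  rewrite dmillsE; have -> : gcdf_int (- a) = gcdf_int a - a by have := @gcdf_int_sub R a; lra.
  ring.
have [xa|ax|->] := ltgtP x a.
- apply: (near_eq_is_derive (f := fun y => - gcdf_int (- a) * mills y)).
    near=> y; rewrite /stein_hinge ifT// ltW//.
    by near: y; exact: lt_nbhsl.
  by apply: is_derive_eq (dl x) _; rewrite /stein_hinge (ltW xa) (max_idPr _) ?addr0//; lra.
- apply: (near_eq_is_derive (f := fun y => - 1 + gcdf_int a * mills (- y))).
    near=> y; rewrite /stein_hinge ifF//; apply/negbTE; rewrite -ltNge.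
    by near: y; exact: lt_nbhsr.
  by apply: is_derive_eq (dr x) _; rewrite /stein_hinge leNgt ax/= (max_idPl _)//; lra.
- apply: is_derive_glue.
  + exact: stein_hinge_match.
  + by apply: is_derive_eq (dl a) _; rewrite /stein_hinge lexx subrr maxxx addr0.
  + apply: is_derive_eq (dr a) _.
    by rewrite /stein_hinge lexx subrr maxxx !addr0 stein_hinge_match.
Unshelve. all: by end_near. Qed.

(** Both pieces are monotone in [mills], so the extreme value to control is the one at the kink,
    where the Wronskian identity applies. *)
Lemma stein_hinge_range a x : -1 <= stein_hinge a x <= 0.
Proof.
have b b' : gcdf_int (- b') * mills b' <= 1.
  rewrite mulrA ler_pdivrMr ?gpdf_gt0// mul1r -gcdf_int_wronskian.
  by rewrite lerDr mulr_ge0// ltW ?gcdf_int_gt0 ?gcdf_gt0.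
have := gcdf_int_gt0 a; have := gcdf_int_gt0 (- a).
rewrite /stein_hinge; case: (leP x a) => xa gNa ga.
  have m1 := mills_le _ _ xa; have m0 := mills_gt0 x; have := b a.
  have : 0 <= gcdf_int (- a) * mills x by rewrite mulr_ge0 ?ltW.
  have : gcdf_int (- a) * mills x <= gcdf_int (- a) * mills a.
    by rewrite ler_wpM2l// ltW.
  by rewrite mulNr; lra.
have m1 : mills (- x) <= mills (- a) by apply: mills_le; lra.
have m0 := mills_gt0 (- x); have := b (- a); rewrite opprK => m2.
have : 0 <= gcdf_int a * mills (- x) by rewrite mulr_ge0 ?ltW.
have : gcdf_int a * mills (- x) <= gcdf_int a * mills (- a).
  by rewrite ler_wpM2l// ltW.
by lra.
Qed.

Definition stein_lip : R := mills 0 + gcdf_int 0.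

(** The bound must be uniform in [a], since rescaling moves the kink. By symmetry take [b >= 0] and
    split [gcdf_int b = b + gcdf_int (- b)]; the two resulting products give the two summands of
    [stein_lip]. *)
Lemma gcdf_int_mul_dmills_le a : gcdf_int (- a) * dmills a <= stein_lip.
Proof.
suff H (b : R) : 0 <= b -> gcdf_int (- b) * gcdf_int b <= stein_lip * gpdf b.
  rewrite /dmills mulrA ler_pdivrMr ?gpdf_gt0//.
  have [/H//|/ltW a0] := leP 0 a.
  by rewrite mulrC -{1}[a]opprK -[gpdf a]gpdfN H// oppr_ge0.
move=> b0.
have E : gcdf_int b = b + gcdf_int (- b) by have := @gcdf_int_sub R b; lra.
have h1 : b * gcdf_int (- b) <= gcdf (- b).
  by have := @gcdf_add_mul_gcdf_int_ge0 R (- b); lra.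
have h2 : gcdf (- b) <= mills 0 * gpdf b.
  rewrite -ler_pdivrMr ?gpdf_gt0// -gpdfN.
  by apply: (mills_le (- b) 0); rewrite oppr_le0.
have h3 : gcdf_int (- b) <= gpdf b.
  rewrite {1}/gcdf_int gpdfN; have := @gcdf_ge0 R (- b) => h; nra.
have h4 : gcdf_int (- b) <= gcdf_int 0.
  have [->|bn0] := eqVneq b 0; first by rewrite oppr0.
  by apply/ltW/gcdf_int_lt; rewrite oppr_lt0 lt_def bn0.
have h5 := gcdf_int_gt0 (- b).
rewrite E /stein_lip; have := gpdf_gt0 b => h6; nra.
Qed.

Lemma stein_lip_ge0 : 0 <= stein_lip.
Proof. by rewrite addr_ge0// ltW ?mills_gt0 ?gcdf_int_gt0. Qed.

(** The derivative is [- gcdf_int (- a) * dmills c] on the left and [- gcdf_int a * dmills (- c)] on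
    the right. As [dmills] is nondecreasing, its size is largest at the kink. *)
Lemma stein_hinge_lipschitz a x y :
  `|stein_hinge a y - stein_hinge a x| <= stein_lip * `|y - x|.
Proof.
have [c _ ->] := mean_value _ _ x y (is_derive_stein_hinge a).
rewrite normrM ler_wpM2r//.
have [ca|ac] := leP c a.
  have -> : c * stein_hinge a c + Num.max (c - a) 0 - gcdf_int (- a)
      = - (gcdf_int (- a) * dmills c).
    by rewrite /stein_hinge ca (max_idPr _) ?dmillsE; [ring|lra].
  rewrite normrN ger0_norm; last by rewrite mulr_ge0// ltW ?gcdf_int_gt0 ?dmills_gt0.
  apply: le_trans (gcdf_int_mul_dmills_le a).
  by rewrite ler_wpM2l ?dmills_le// ltW ?gcdf_int_gt0.
have -> : c * stein_hinge a c + Num.max (c - a) 0 - gcdf_int (- a)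
    = - (gcdf_int a * dmills (- c)).
  rewrite /stein_hinge leNgt ac/= (max_idPl _) ?dmillsE; last lra.
  have -> : gcdf_int (- a) = gcdf_int a - a by have := @gcdf_int_sub R a; lra.
  ring.
rewrite normrN ger0_norm; last by rewrite mulr_ge0// ltW ?gcdf_int_gt0 ?dmills_gt0.
apply: le_trans (gcdf_int_mul_dmills_le (- a)).
rewrite opprK ler_wpM2l ?(ltW (gcdf_int_gt0 _))//.
by apply: dmills_le; rewrite lerN2 ltW.
Qed.

End SteinHinge.

(** * Normal expectations *)

Section GaussianIntegrals.
Context {R : realType}.
Implicit Types (k f : R -> R) (a x y : R).
Local Notation mu := (@lebesgue_measure R).
Local Notation nu := (normal_prob (0 : R) 1).

Definition gauss_integrable k := nu.-integrable setT (EFin \o k).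

Lemma measurable_gpdf : measurable_fun [set: R] (@gpdf R).
Proof. exact: measurable_normal_pdf. Qed.

Lemma integral_gaussE k : gauss_integrable k ->
  (\int[nu]_x (k x)%:E = \int[mu]_x (k x * gpdf x)%:E)%E.
Proof.
move=> ik; have mk := measurable_int _ ik.
rewrite -(Radon_Nikodym_change_of_variables (normal_prob_dominates 0 1))//.
under [RHS]eq_integral do rewrite EFinM.
apply: ae_eq_integral => //.
- apply: emeasurable_funM => //; apply: (measurable_int mu).
  by apply: Radon_Nikodym_integrable; exact: normal_prob_dominates.
- apply: emeasurable_funM => //.
  by apply/measurable_EFinP; exact: measurable_gpdf.
- apply: ae_eqe_mul2l => /=.
  rewrite Radon_NikodymE//=; first exact: normal_prob_dominates.
  move=> dom; case: cid => /= h [h1 h2 h3].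
  apply: integral_ae_eq => //=.
    by apply/measurable_EFinP; exact: measurable_gpdf.
  by move=> E _ mE; rewrite -h3.
Qed.

(** The density formula [integral_gaussE] presupposes integrability, so it is applied to the bounded
    truncations of [k], followed by monotone convergence. *)
Lemma ge0_gauss_integrable k : measurable_fun [set: R] k ->
    (forall x, 0 <= k x) ->
    (\int[mu]_x (k x * gpdf x)%:E < +oo)%E ->
  gauss_integrable k.
Proof.
move=> mk k0 kfin.
have mEk : measurable_fun [set: R] (EFin \o k) by exact/measurable_EFinP.
apply/integrableP; split => //.
under eq_integral do rewrite /= ger0_norm//.
pose g (n : nat) x := (Num.min (k x) n%:R)%:E.
have mg n : measurable_fun [set: R] (g n).
  by apply/measurable_EFinP/measurable_minr.
have -> : (\int[nu]_x (k x)%:E = \int[nu]_x (limn (g^~ x)))%E.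
  apply: eq_integral => x _; apply/esym; apply: lim_near_cst => //.
  near=> n; rewrite /g min_l//.
  by near: n; exact: nbhs_infty_ger.
rewrite monotone_convergence//; last 2 first.
- by move=> n x _; rewrite lee_fin le_min k0/=.
- move=> x _ m n mn; rewrite lee_fin le_min ge_min lexx/= ge_min ler_nat mn orbT.
  by [].
apply: le_lt_trans kfin; apply: lime_le.
  apply: ereal_nondecreasing_is_cvgn => m n mn; apply: ge0_le_integral => //.
  - by move=> x _; rewrite lee_fin le_min k0/=.
  - exact: mg.
  - exact: mg.
  - by move=> x _; rewrite lee_fin le_min ge_min lexx/= ge_min ler_nat mn orbT.
near=> n; rewrite integral_gaussE; last first.
  apply: measurable_bounded_integrable => //.
  - exact: le_lt_trans (probability_le1 nu measurableT) (ltry 1).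
  - by apply: measurable_minr.
  - exists n%:R; split; first exact: num_real.
    move=> M nM x _ /=; rewrite ger0_norm ?le_min ?k0//=.
    by rewrite ge_min (ltW nM) orbT.
apply: ge0_le_integral => //.
- by move=> x _; rewrite lee_fin mulr_ge0 ?le_min ?k0//= ltW ?gpdf_gt0.
- apply/measurable_EFinP/measurable_funM; last exact: measurable_gpdf.
  by apply: measurable_minr.
- by apply/measurable_EFinP/measurable_funM => //; exact: measurable_gpdf.
- by move=> x _; rewrite lee_fin ler_wpM2r ?ge_min ?lexx// ltW ?gpdf_gt0.
Unshelve. all: by end_near. Qed.

Lemma ge0_FTC2y f (F : R -> R) a (l : R) :
    continuous f -> (forall x, a <= x -> 0 <= f x) ->
    (forall x, is_derive x 1 F (f x)) -> F x @[x --> +oo] --> l ->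
  (\int[mu]_(x in `[a, +oo[) (f x)%:E = (l - F a)%:E)%E.
Proof.
move=> cf f0 dF Fl; rewrite (ge0_continuous_FTC2y (F := F) (l := l))//.
- exact: continuous_subspaceT.
- by apply: cvg_at_right_filter; exact: (is_derive_cvg _ _ _ (dF a)).
- by move=> x _; rewrite derive1E; have [_ ->] := dF x.
Qed.

Lemma ge0_FTC2Ny f (F : R -> R) a (l : R) :
    continuous f -> (forall x, x <= a -> 0 <= f x) ->
    (forall x, is_derive x 1 F (f x)) -> F x @[x --> -oo] --> l ->
  (\int[mu]_(x in `]-oo, a]) (f x)%:E = (F a - l)%:E)%E.
Proof.
move=> cf f0 dF Fl; rewrite -[a]opprK ge0_integration_by_substitutionNy; last 2 first.
- exact: continuous_subspaceT.
- by move=> x; rewrite in_itv/= opprK => /ltW/f0.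
have dG x : is_derive x 1 (fun x => - F (- x)) ((f \o -%R) x).
  by isder_eq ltac:(exact: dF); rewrite /=; ring.
rewrite (ge0_FTC2y _ _ _ (- l) _ _ dG).
- by congr EFin; rewrite !opprK; ring.
- by move=> x; apply: continuous_comp; [exact: opp_continuous|exact: cf].
- by move=> x xa; apply: f0; rewrite lerNl.
- by apply: (@cvgN _ R^o); exact: ((cvgNy_compNP F (nbhs l)).1 Fl).
Qed.

(* [k * gpdf] may be given by different formulas on the two sides of [a]; each
   formula is required to be smooth, with a primitive, on the whole line. *)
Record gauss_pieces k (a v : R) : Prop := GaussPieces {
  pieces_cont : continuous k;
  pieces_ge0 : forall x, 0 <= k x;
  pieces_prim : exists kl kr KL KR : R -> R, exists l r : R,
    [/\ (forall x, x <= a -> kl x = k x * gpdf x),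
        (forall x, a <= x -> kr x = k x * gpdf x),
        (forall x, is_derive x 1 KL (kl x)) /\ (forall x, is_derive x 1 KR (kr x)),
        continuous kl /\ continuous kr &
        [/\ KL x @[x --> -oo] --> l, KR x @[x --> +oo] --> r
          & v = KL a - l + (r - KR a)]] }.

Lemma integral_gauss_pieces k a v : gauss_pieces k a v ->
  (\int[mu]_x (k x * gpdf x)%:E = v%:E)%E.
Proof.
move=> [ck k0 [kl [kr [KL [KR [l [r [klE krE [dl dr] [cl cr] [Kl Kr ->]]]]]]]]].
have mkg : measurable_fun [set: R] (fun x => (k x * gpdf x)%:E).
  apply/measurable_EFinP/measurable_funM; last exact: measurable_gpdf.
  exact: continuous_measurable_fun.
have kg0 x : 0 <= k x * gpdf x by rewrite mulr_ge0 ?k0// ltW ?gpdf_gt0.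
have -> : [set: R] = `]-oo, a] `|` `]a, +oo[.
  apply/esym/seteqP; split => // x _ /=; rewrite !in_itv/= andbT.
  by case: leP; [left|right].
rewrite ge0_integral_setU//=; last 3 first.
- exact: measurable_funS mkg.
- by move=> x _; rewrite lee_fin.
- apply/disj_setPS => x [] /=; rewrite !in_itv/= andbT => xa.
  by rewrite ltNge xa.
rewrite integral_itv_obnd_cbnd; last exact: measurable_funS mkg.
rewrite EFinD; congr (_ + _)%E.
- rewrite -(ge0_FTC2Ny kl _ _ _ cl _ dl Kl)//.
    by apply: eq_integral => x; rewrite inE/= in_itv/= => xa; rewrite klE.
  by move=> x xa; rewrite klE.
- rewrite -(ge0_FTC2y kr _ _ _ cr _ dr Kr)//.
    by apply: eq_integral => x; rewrite inE/= in_itv/= andbT => xa; rewrite krE.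
  by move=> x xa; rewrite krE.
Qed.

Lemma gauss_pieces_integrable k a v : gauss_pieces k a v -> gauss_integrable k.
Proof.
move=> kp; have [ck k0 _] := kp; apply: ge0_gauss_integrable => //.
  exact: continuous_measurable_fun.
by rewrite (integral_gauss_pieces _ _ _ kp) ltry.
Qed.

Lemma gaussE_pieces k a v : gauss_pieces k a v -> gaussE k = v.
Proof.
move=> kp; rewrite /gaussE unlock integral_gaussE.
  by rewrite (integral_gauss_pieces _ _ _ kp).
exact: gauss_pieces_integrable kp.
Qed.

Lemma gauss_pieces_opp k a v : gauss_pieces k a v ->
  gauss_pieces (k \o -%R) (- a) v.
Proof.
move=> [ck k0 [kl [kr [KL [KR [l [r [klE krE [dl dr] [cl cr] [Kl Kr ->]]]]]]]]].
have copp (g : R -> R) : continuous g -> continuous (g \o -%R).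
  by move=> cg x; apply: continuous_comp; [exact: opp_continuous|exact: cg].
split; [exact: copp|by move=> x; exact: k0|].
exists (kr \o -%R), (kl \o -%R), (fun x => - KR (- x)), (fun x => - KL (- x)).
exists (- r), (- l); split.
- by move=> x xa /=; rewrite krE ?gpdfN// lerNr.
- by move=> x xa /=; rewrite klE ?gpdfN// lerNl.
- split=> x /=.
  + by isder_eq ltac:(exact: dr); ring.
  + by isder_eq ltac:(exact: dl); ring.
- by split; exact: copp.
- split.
  + by apply: (@cvgN _ R^o); exact: ((cvgy_compNP KR (nbhs r)).1 Kr).
  + by apply: (@cvgN _ R^o); exact: ((cvgNy_compNP KL (nbhs l)).1 Kl).
  + by rewrite !opprK; ring.
Qed.

End GaussianIntegrals.

(** * Expectations of the hinge, the absolute value and the Stein solution *)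

Section GaussianExpectation.
Context {R : realType}.
Implicit Types (k f : R -> R) (a c x y : R).
Local Notation nu := (normal_prob (0 : R) 1).

Lemma gaussE_Rintegral k : gaussE k = (\int[nu]_x k x)%R.
Proof. by rewrite /gaussE unlock. Qed.

Lemma gauss_integrable_bounded k (M : R) : continuous k ->
  (forall x, `|k x| <= M) -> gauss_integrable k.
Proof.
move=> ck kM; apply: measurable_bounded_integrable => //.
- exact: le_lt_trans (probability_le1 nu measurableT) (ltry 1).
- exact: continuous_measurable_fun.
- exists M; split; first exact: num_real.
  by move=> N MN x _ /=; rewrite (le_trans (kM x))// ltW.
Qed.

Lemma gauss_integrable_cst c : gauss_integrable (fun=> c).
Proof. by apply: (gauss_integrable_bounded _ `|c|) => // x; exact: cvg_cst. Qed.

Lemma gauss_integrableD k f : gauss_integrable k -> gauss_integrable f ->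
  gauss_integrable (fun x => k x + f x).
Proof. by move=> ik jf; exact: (integrableD measurableT ik jf). Qed.

Lemma gauss_integrableZ c k : gauss_integrable k ->
  gauss_integrable (fun x => c * k x).
Proof. by move=> ik; exact: (integrableZl measurableT c ik). Qed.

Lemma gaussED k f : gauss_integrable k -> gauss_integrable f ->
  gaussE (fun x => k x + f x) = gaussE k + gaussE f.
Proof. by move=> ik jf; rewrite !gaussE_Rintegral RintegralD. Qed.

Lemma gaussEZ c k : gauss_integrable k ->
  gaussE (fun x => c * k x) = c * gaussE k.
Proof. by move=> ik; rewrite !gaussE_Rintegral RintegralZl. Qed.

Lemma gaussE_cst c : gaussE (fun=> c) = c.
Proof.
rewrite gaussE_Rintegral Rintegral_cst//=.
by rewrite (@probability_setT _ _ _ nu) mulr1.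
Qed.

Lemma le_gaussE k f : gauss_integrable k -> gauss_integrable f ->
  (forall x, k x <= f x) -> gaussE k <= gaussE f.
Proof. by move=> ik jf kf; rewrite !gaussE_Rintegral le_Rintegral. Qed.

Lemma gpdf_cvgy : gpdf x @[x --> +oo] --> (0 : R).
Proof.
have -> : gpdf = gpdf \o -%R :> (R -> R).
  by apply/funext => x /=; rewrite gpdfN.
exact: ((cvgNy_compNP gpdf (nbhs (0 : R))).1 gpdf_cvgNy).
Qed.

Lemma gcdf_int_cvgy : gcdf_int (- x) @[x --> +oo] --> (0 : R).
Proof. exact: ((cvgNy_compNP gcdf_int (nbhs (0 : R))).1 gcdf_int_cvgNy). Qed.

Lemma hinge_continuous (c : R) : continuous (fun x : R => Num.max (x - c) 0).
Proof.
move=> x.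
apply: (@continuous_max R R^o (fun y : R => y - c) (fun=> 0)); last exact: cvg_cst.
by apply: (@cvgB _ R^o); [exact: cvg_id|exact: cvg_cst].
Qed.

Lemma hinge_pieces a : gauss_pieces (fun z => Num.max (z - a) 0) a (gcdf_int (- a)).
Proof.
split; [exact: hinge_continuous|by move=> x; rewrite le_max lexx orbT|].
exists (fun=> 0), (fun x => (x - a) * gpdf x), (fun=> 0).
exists (fun x => - gpdf x - a * gcdf x), 0, (- a); split.
- by move=> x xa; rewrite (max_idPr _) ?mul0r// subr_le0.
- by move=> x xa; rewrite (max_idPl _)// subr_ge0.
- split=> x; first exact: is_derive_fun_cst.
  by isder; ring.
- split; first by move=> x; exact: cvg_cst.
  move=> x; apply: cvgM; last exact: continuous_gpdf.
  by apply: (@cvgB _ R^o); [exact: cvg_id|exact: cvg_cst].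
- split; first exact: cvg_cst.
  + rewrite (_ : - a = - 0 - a * 1); last by ring.
    apply: (@cvgB _ R^o); first by apply: (@cvgN _ R^o); exact: gpdf_cvgy.
    by apply: cvgM; [exact: cvg_cst|exact: gcdf_cvgy].
  + by rewrite /gcdf_int gcdfN gpdfN; ring.
Qed.

Lemma norm_pieces : gauss_pieces (fun z : R => `|z|) 0 (2 * gpdf 0).
Proof.
split; [exact: norm_continuous|by []|].
exists (fun x => - x * gpdf x), (fun x => x * gpdf x), gpdf.
exists (fun x => - gpdf x), 0, 0; split.
- by move=> x x0; rewrite ler0_norm.
- by move=> x x0; rewrite ger0_norm.
- by split=> x; isder; ring.
- split=> x; (apply: cvgM; last exact: continuous_gpdf); last exact: cvg_id.
  by apply: (@cvgN _ R^o); exact: cvg_id.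
- split; first exact: gpdf_cvgNy.
  + by rewrite -oppr0; apply: (@cvgN _ R^o); exact: gpdf_cvgy.
  + by ring.
Qed.

Lemma stein_hinge_continuous a : continuous (stein_hinge a).
Proof. exact: derivable_continuous (is_derive_stein_hinge a). Qed.

(** The density turns [mills] into [gcdf], with primitive [gcdf_int]. The products
    [gcdf_int a * gcdf_int (- a)] from the two sides cancel, leaving the probability of [Z > a], the
    mean slope of the hinge. *)
Lemma stein_hinge_pieces a :
  gauss_pieces (fun z => - stein_hinge a z) a (gcdf (- a)).
Proof.
have cg : continuous (@gcdf R) by exact: derivable_continuous is_derive_gcdf.
split.
- by move=> x; apply: (@cvgN _ R^o); exact: stein_hinge_continuous.
- by move=> x; have := stein_hinge_range a x; lra.
exists (fun x => gcdf_int (- a) * gcdf x).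
exists (fun x => gpdf x - gcdf_int a * gcdf (- x)).
exists (fun x => gcdf_int (- a) * gcdf_int x).
exists (fun x => gcdf x + gcdf_int a * gcdf_int (- x)), 0, 1; split.
- move=> x xa; rewrite /stein_hinge xa /mills; field.
  by rewrite gt_eqF ?gpdf_gt0.
- move=> x; rewrite le_eqVlt => /predU1P[<-|ax].
    rewrite /stein_hinge lexx /mills -(gcdf_int_wronskian a); field.
    by rewrite gcdf_int_wronskian gt_eqF ?gpdf_gt0.
  rewrite /stein_hinge leNgt ax/= /mills gpdfN; field.
  by rewrite gt_eqF ?gpdf_gt0.
- by split=> x; isder; ring.
- split=> x.
    by apply: cvgM; [exact: cvg_cst|exact: cg].
  apply: (@cvgB _ R^o); first exact: continuous_gpdf.
  apply: cvgM; first exact: cvg_cst.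
  by apply: continuous_comp; [exact: opp_continuous|exact: cg].
- split.
  + rewrite -(mulr0 (gcdf_int (- a))).
    by apply: cvgM; [exact: cvg_cst|exact: gcdf_int_cvgNy].
  + rewrite (_ : 1 = 1 + gcdf_int a * 0); last by ring.
    apply: (@cvgD _ R^o); first exact: gcdf_cvgy.
    by apply: cvgM; [exact: cvg_cst|exact: gcdf_int_cvgy].
  + by rewrite gcdfN; ring.
Qed.

Lemma gauss_integrable_stein_hinge (s : R) a :
  gauss_integrable (fun z => stein_hinge a (s * z)).
Proof.
apply: (gauss_integrable_bounded _ 1).
  move=> x; apply: continuous_comp; last exact: stein_hinge_continuous.
  by apply: cvgM; [exact: cvg_cst|exact: cvg_id].
by move=> x; rewrite ler_norml; have := stein_hinge_range a (s * x); lra.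
Qed.

Lemma gaussE_stein_hinge a : gaussE (stein_hinge a) = - gcdf (- a).
Proof.
have H := stein_hinge_pieces a; rewrite -(gaussE_pieces _ _ _ H).
rewrite -mulN1r -gaussEZ; last exact: gauss_pieces_integrable H.
by congr gaussE; apply/funext => z; rewrite mulN1r opprK.
Qed.

Lemma gaussE_stein_hinge_opp a :
  gaussE (fun z => stein_hinge a (- z)) = - gcdf (- a).
Proof.
have H := gauss_pieces_opp _ _ _ (stein_hinge_pieces a).
rewrite -(gaussE_pieces _ _ _ H).
rewrite -mulN1r -gaussEZ; last exact: gauss_pieces_integrable H.
by congr gaussE; apply/funext => z /=; rewrite mulN1r opprK.
Qed.

(** The Lipschitz bound integrated against the law of Z; [2 * gpdf 0] is the mean of [|Z|]. *)
Lemma gaussE_stein_hinge_scale a (e s : R) :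
  `|gaussE (fun z => stein_hinge a (e * (s * z)))
    - gaussE (fun z => stein_hinge a (e * z))|
    <= stein_lip * `|e| * `|1 - s| * (2 * gpdf 0).
Proof.
have i1 : gauss_integrable (fun z => stein_hinge a (e * (s * z))).
  have := gauss_integrable_stein_hinge (e * s) a.
  by under eq_fun do rewrite -mulrA.
have i2 := gauss_integrable_stein_hinge e a.
have iN := gauss_pieces_integrable _ _ _ norm_pieces.
have step : forall k f, gauss_integrable k -> gauss_integrable f ->
    (forall z, k z - f z <= stein_lip * `|e| * `|1 - s| * `|z|) ->
    gaussE k - gaussE f <= stein_lip * `|e| * `|1 - s| * (2 * gpdf 0).
  move=> k f ik jf kf; rewrite -(gaussE_pieces _ _ _ norm_pieces) -gaussEZ//.
  rewrite lerBlDl -gaussED//; last exact: gauss_integrableZ.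
  apply: le_gaussE => //; first by apply: gauss_integrableD => //; exact: gauss_integrableZ.
  by move=> z; rewrite -lerBlDl.
have bound z : `|stein_hinge a (e * (s * z)) - stein_hinge a (e * z)|
    <= stein_lip * `|e| * `|1 - s| * `|z|.
  apply: le_trans (stein_hinge_lipschitz _ _ _) _.
  rewrite -!mulrA ler_wpM2l ?stein_lip_ge0// -!normrM distrC.
  by rewrite (_ : e * z - e * (s * z) = e * ((1 - s) * z)); [|ring].
rewrite ler_norml lerNl opprB; apply/andP; split; apply: step => // z.
  by apply: le_trans (bound z); rewrite -opprB (le_trans (ler_norm _))// normrN.
exact: le_trans (ler_norm _) (bound z).
Qed.

Lemma integral_std_normal_cdf (y : R) :
  (\int[lebesgue_measure]_(x in `]-oo, y]) std_normal_cdf x = (gcdf_int y)%:E)%E.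
Proof.
under eq_integral do rewrite /std_normal_cdf gcdfE.
rewrite (ge0_FTC2Ny _ _ _ 0 _ _ is_derive_gcdf_int).
- by rewrite subr0.
- exact: derivable_continuous is_derive_gcdf.
- by move=> x _; exact: gcdf_ge0.
- exact: gcdf_int_cvgNy.
Qed.

End GaussianExpectation.

(** * Uniqueness of the bounded Stein solution *)

Section SteinUniqueness.
Context {R : realType}.
Implicit Types (mu sigma x y : R).

(** The difference [d] of two solutions satisfies [sigma ^+ 2 * d' = (x - mu) * d], so [d] times a
    Gaussian weight is constant. The weight tends to 0 and [d] is bounded, which forces [d = 0]. *)
Lemma stein_sol_unique mu sigma (h f g : R -> R) : 0 < sigma ->
  is_stein_sol mu sigma h f -> is_stein_sol mu sigma h g -> f = g.
Proof.
move=> s0 [bf ef] [bg eg]; apply/funext => x.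
have s2 : 0 < sigma ^+ 2 by rewrite exprn_gt0.
have sn : sigma != 0 by rewrite gt_eqF.
pose E y := expR ((y - mu) * (y - mu) * (- (2 * sigma ^+ 2)^-1)).
have dE y : is_derive y 1 E (- (y - mu) / sigma ^+ 2 * E y).
  rewrite /E; isder; field.
  by rewrite sn.
have dk y : is_derive y 1 (fun y => (f y - g y) * E y) 0.
  have [df fE] := ef y; have [dg gE] := eg y.
  have {}df := derivableP df; have {}dg := derivableP dg.
  isder_eq ltac:(first [exact: df|exact: dg|exact: dE]).
  rewrite -!derive1E.
  have -> : derive1 f y = ((y - mu) * f y + (h y - gaussE (fun z => h (mu + sigma * z))))
      / sigma ^+ 2 by rewrite -fE; field.
  have -> : derive1 g y = ((y - mu) * g y + (h y - gaussE (fun z => h (mu + sigma * z))))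
      / sigma ^+ 2 by rewrite -gE; field.
  by field.
have kc y : (f y - g y) * E y = (f x - g x) * E x.
  exact: (is_derive_0_is_cst y x dk).
have [M1 HM1] : exists M, forall y, `|f y| <= M.
  have [M [_ HM]] := bf; exists (M + 1) => y; apply: (HM (M + 1)) => //; lra.
have [M2 HM2] : exists M, forall y, `|g y| <= M.
  have [M [_ HM]] := bg; exists (M + 1) => y; apply: (HM (M + 1)) => //; lra.
apply/eqP; rewrite -subr_eq0 -normr_eq0 eq_le normr_ge0 andbT leNgt.
apply/negP => d0.
have E0 y : 0 < E y by exact: expR_gt0.
set c := `|f x - g x| * E x.
have c0 : 0 < c by rewrite mulr_gt0.
pose M := M1 + M2.
have cM y : c <= M * E y.
  rewrite /c -(gtr0_norm (E0 x)) -normrM -(kc y) normrM (gtr0_norm (E0 y)).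
  rewrite ler_wpM2r ?(ltW (E0 _))//.
  by rewrite (le_trans (ler_normB _ _))// lerD.
have M0 : 0 < M.
  have := cM x; have := E0 x => e0 h0.
  by rewrite -(pmulr_lgt0 _ e0) (lt_le_trans c0).
(* Far away from [mu] the weight [E] is smaller than [c / M]. *)
pose t := M / c; have t0 : 0 < t by rewrite divr_gt0.
pose y := mu + 2 * sigma ^+ 2 * t + 1.
have := cM y; rewrite -ler_pdivrMl// leNgt => /negP; apply.
rewrite /E /y mulrN expRN.
have -> : M^-1 * c = t^-1 by rewrite /t; field; rewrite !gt_eqF.
rewrite ltf_pV2 ?posrE ?expR_gt0//.
apply: lt_le_trans (expR_ge1Dx _).
have : t <= (mu + 2 * sigma ^+ 2 * t + 1 - mu)
    * (mu + 2 * sigma ^+ 2 * t + 1 - mu) / (2 * sigma ^+ 2).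
  have p0 : 0 < 2 * sigma ^+ 2 by rewrite mulr_gt0.
  rewrite ler_pdivlMr//.
  have st0 : 0 < 2 * sigma ^+ 2 * t by rewrite mulr_gt0.
  have -> : mu + 2 * sigma ^+ 2 * t + 1 - mu = 2 * sigma ^+ 2 * t + 1 by ring.
  by rewrite mulrC; move: (_ * t) st0 => u u0; nra.
by move=> /le_lt_trans; apply; rewrite ltrDr.
Qed.

End SteinUniqueness.

(** * The Stein move for the two-hinge potential *)

Section TwoHinges.
Context {R : realType}.
Implicit Types (a A s mu sigma rho q x y : R).

Definition two_hinges a A s : R := Num.max (s - a) 0 + Num.max (- s - a) 0 - A.

(** Here [q] is the standard deviation of the heat flow, the square root of the remaining
    variance. *)
Definition two_hinges_heat a A s q : R :=
  q * gcdf_int ((s - a) / q) + q * gcdf_int ((- s - a) / q) - A.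

Lemma gaussE_two_hinges a A mu sigma : 0 < sigma ->
  gaussE (fun z => two_hinges a A (mu + sigma * z)) = two_hinges_heat a A mu sigma.
Proof.
move=> s0; have sn : sigma != 0 by rewrite gt_eqF.
have hp := hinge_pieces ((a - mu) / sigma).
have hq := gauss_pieces_opp _ _ _ (hinge_pieces ((a + mu) / sigma)).
have ip := gauss_pieces_integrable _ _ _ hp.
have iq := gauss_pieces_integrable _ _ _ hq.
have -> : (fun z => two_hinges a A (mu + sigma * z)) = (fun z =>
    (sigma * Num.max (z - (a - mu) / sigma) 0
     + sigma * Num.max (- z - (a + mu) / sigma) 0) + - A).
  apply/funext => z; rewrite /two_hinges !maxr_pMr ?(ltW s0)// !mulr0.
  by congr (Num.max _ _ + Num.max _ _ + _); field.
have i1 := gauss_integrableZ sigma _ ip.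
have i2 := gauss_integrableZ sigma _ iq.
rewrite gaussED ?gaussE_cst; last 2 first.
- exact: gauss_integrableD.
- exact: gauss_integrable_cst.
rewrite gaussED// !gaussEZ// (gaussE_pieces _ _ _ hp) (gaussE_pieces _ _ _ hq).
by rewrite /two_hinges_heat; congr (_ * gcdf_int _ + _ * gcdf_int _ - _); field.
Qed.

(** The Stein solution of the standardized problem for each hinge. Reflecting a hinge reflects its
    solution and flips the sign; the scale of the hinge cancels against [sigma]. *)
Definition stein_two_hinges a mu sigma x : R :=
  stein_hinge ((a - mu) / sigma) ((x - mu) / sigma)
  - stein_hinge ((a + mu) / sigma) (- ((x - mu) / sigma)).

Lemma stein_two_hinges_range a mu sigma x :
  -1 <= stein_two_hinges a mu sigma x <= 1.
Proof.
rewrite /stein_two_hinges.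
have := stein_hinge_range ((a - mu) / sigma) ((x - mu) / sigma).
have := stein_hinge_range ((a + mu) / sigma) (- ((x - mu) / sigma)).
lra.
Qed.

Lemma stein_sol_two_hinges a A mu sigma : 0 < sigma ->
  stein_sol mu sigma (two_hinges a A) = stein_two_hinges a mu sigma.
Proof.
move=> s0; have sn : sigma != 0 by rewrite gt_eqF.
apply: xget_subset1; last by move=> f g; exact: stein_sol_unique.
split.
  exists 1; split; first exact: num_real.
  move=> M M1 x _ /=; rewrite ler_norml.
  by have := stein_two_hinges_range a mu sigma x; lra.
move=> x; rewrite gaussE_two_hinges//.
set y := (x - mu) / sigma.
have d : is_derive x 1 (stein_two_hinges a mu sigma)
    ((two_hinges a A x - two_hinges_heat a A mu sigma
      + (x - mu) * stein_two_hinges a mu sigma x) / sigma ^+ 2).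
  rewrite /stein_two_hinges.
  isder_eq ltac:(exact: is_derive_stein_hinge); rewrite -/y.
  have -> : two_hinges a A x = sigma * Num.max (y - (a - mu) / sigma) 0
     + sigma * Num.max (- y - (a + mu) / sigma) 0 - A.
    rewrite /two_hinges !maxr_pMr ?(ltW s0)// !mulr0 /y.
    by congr (Num.max _ _ + Num.max _ _ + _); field.
  have -> : x - mu = sigma * y by rewrite /y; field.
  rewrite /two_hinges_heat.
  have -> : (mu - a) / sigma = - ((a - mu) / sigma) by field.
  have -> : (- mu - a) / sigma = - ((a + mu) / sigma) by field.
  by field.
split; first by case: d.
by rewrite derive1E; case: d => _ ->; field.
Qed.

(** The derivative of [two_hinges_heat] in [s]. *)
Definition two_hinges_slope a s q : R :=
  gcdf ((s - a) / q) - gcdf ((- s - a) / q).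

(** Two hinges, each contributing [stein_lip] times the mean [2 * gpdf 0] of [|Z|]. *)
Definition stein_move_const : R := 4 * stein_lip * gpdf 0.

Lemma stein_move_const_ge0 : 0 <= stein_move_const.
Proof. by rewrite !mulr_ge0 ?stein_lip_ge0// ltW ?gpdf_gt0. Qed.

Lemma gauss_integrable_stein_two_hinges a mu sigma rho :
  gauss_integrable (fun z => stein_two_hinges a mu sigma (mu + rho * z)).
Proof.
apply: (gauss_integrable_bounded _ 1).
  move=> x; rewrite /stein_two_hinges.
  notypeclasses refine (is_derive_cvg _ _ _ _).
  by isder_with ltac:(exact: is_derive_stein_hinge).
by move=> x; rewrite ler_norml stein_two_hinges_range.
Qed.

Lemma gaussE_stein_two_hinges_range a mu sigma rho :
  -1 <= gaussE (fun z => stein_two_hinges a mu sigma (mu + rho * z)) <= 1.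
Proof.
have i := gauss_integrable_stein_two_hinges a mu sigma rho.
rewrite -{1}(gaussE_cst (-1)) -{2}(gaussE_cst 1).
by apply/andP; split; apply: le_gaussE => //; try exact: gauss_integrable_cst;
  move=> z; have := stein_two_hinges_range a mu sigma (mu + rho * z); lra.
Qed.

(** With [rho] equal to [sigma] the mean would be exactly minus the slope, by [gaussE_stein_hinge];
    the error comes from the ratio [rho / sigma]. *)
Lemma stein_move_slope a mu sigma rho : 0 < sigma -> 0 <= rho ->
    sigma ^+ 2 = rho ^+ 2 + 1 ->
  `|gaussE (fun z => stein_two_hinges a mu sigma (mu + rho * z))
    + two_hinges_slope a mu sigma| <= stein_move_const / sigma ^+ 2.
Proof.
move=> s0 r0 sr; have sn : sigma != 0 by rewrite gt_eqF.
set al := (a - mu) / sigma; set be := (a + mu) / sigma.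
have -> : (fun z => stein_two_hinges a mu sigma (mu + rho * z)) = (fun z =>
    stein_hinge al (1 * (rho / sigma * z))
    + (-1) * stein_hinge be (-1 * (rho / sigma * z))).
  apply/funext => z; rewrite /stein_two_hinges -/al -/be mulN1r.
  by congr (stein_hinge _ _ - stein_hinge _ _); field.
have I e c : gauss_integrable (fun z => stein_hinge c (e * (rho / sigma * z))).
  have := gauss_integrable_stein_hinge (e * (rho / sigma)) c.
  by under eq_fun do rewrite -mulrA.
rewrite gaussED//; last exact: gauss_integrableZ.
rewrite gaussEZ//.
have -> : two_hinges_slope a mu sigma =
    - gaussE (fun z => stein_hinge al (1 * z))
    + gaussE (fun z => stein_hinge be (-1 * z)).
  have -> : (fun z => stein_hinge al (1 * z)) = stein_hinge al.
    by apply/funext => z; rewrite mul1r.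
  have -> : (fun z => stein_hinge be (-1 * z)) = (fun z => stein_hinge be (- z)).
    by apply/funext => z; rewrite mulN1r.
  rewrite gaussE_stein_hinge gaussE_stein_hinge_opp opprK /two_hinges_slope.
  by congr (gcdf _ - gcdf _); rewrite /al /be; field.
have H1 := gaussE_stein_hinge_scale al 1 (rho / sigma).
have H2 := gaussE_stein_hinge_scale be (-1) (rho / sigma).
(* Since [0 <= rho <= sigma], [sigma * (sigma - rho)] is at most [sigma ^+ 2 - rho ^+ 2 = 1]. *)
have sc : `|1 - rho / sigma| <= 1 / sigma ^+ 2.
  have rs : rho <= sigma by rewrite -(@ler_pXn2r _ 2)// ?nnegrE// ?(ltW s0)// sr lerDl.
  rewrite ger0_norm; last by rewrite subr_ge0 ler_pdivrMr// mul1r.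
  have -> : 1 - rho / sigma = (sigma * (sigma - rho)) / sigma ^+ 2 by field.
  rewrite ler_pM2r ?invr_gt0 ?exprn_gt0//.
  by move: sr; rewrite !expr2; nra.
rewrite normrN normr1 mulr1 in H2; rewrite normr1 mulr1 in H1.
have bnd : stein_lip * `|1 - rho / sigma| * (2 * gpdf 0) <=
    stein_move_const / sigma ^+ 2 / 2.
  have -> : stein_move_const / sigma ^+ 2 / 2 =
      stein_lip * (1 / sigma ^+ 2) * (2 * gpdf 0) by rewrite /stein_move_const; field.
  rewrite ler_wpM2r ?mulr_ge0 ?(ltW (gpdf_gt0 _))//.
  by rewrite ler_wpM2l// stein_lip_ge0.
move: (le_trans H1 bnd) (le_trans H2 bnd).
rewrite !ler_norml; lra.
Qed.

End TwoHinges.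

(** * One step along the heat flow *)

Section HeatStep.
Context {R : realType}.
Implicit Types (a A s g v y t : R).

(** The mean value theorem is applied twice, which gives [c] in place of Taylor's [c / 2]; only the
    order of magnitude matters later. *)
Lemma taylor2_le (K K1 K2 : R -> R) (c : R) : 0 <= c ->
    (forall t, 0 <= t <= 1 -> is_derive t 1 K (K1 t)) ->
    (forall t, 0 <= t <= 1 -> is_derive t 1 K1 (K2 t)) ->
    (forall t, 0 <= t <= 1 -> K2 t <= c) ->
  K 1 <= K 0 + K1 0 + c.
Proof.
move=> c0 d1 d2 K2c.
have mvt (F F' : R -> R) b : 0 <= b <= 1 ->
    (forall t, 0 <= t <= 1 -> is_derive t 1 F (F' t)) ->
    exists2 t, 0 <= t <= b & F b - F 0 = F' t * b.
  move=> /andP[b0 b1] dF; have inb t : t \in `[0, b] -> 0 <= t <= 1.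
    by rewrite in_itv/= => /andP[-> tb]; exact: le_trans tb b1.
  have [||t + E] := @MVT_segment R F F' 0 b b0.
  - by move=> t tb; apply/dF/inb; exact: subset_itv_oo_cc tb.
  - apply: continuous_in_subspaceT => t; rewrite inE/= => tb.
    exact: (is_derive_cvg _ _ _ (dF _ (inb _ tb))).
  by rewrite in_itv/= => H; exists t => //; rewrite E subr0.
have [t t01 E1] := mvt _ _ 1 (ltac:(by rewrite ler01 lexx)) d1.
have /andP[t0 t1] := t01.
have [u /andP[u0 ut] E2] := mvt _ _ t t01 d2.
have u01 : 0 <= u <= 1 by rewrite u0 (le_trans ut t1).
have := K2c u u01 => H.
have : K2 u * t <= c by nra.
by move: E1 E2; rewrite mulr1; lra.
Qed.

(* Follow the heat flow along (y + g t, v + 1 - t^2): to second order in [t] the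
   drift [g^2 - 1] is all that is left, up to third and fourth space derivatives
   of size O(1 / v). *)
Section Path.
Variables y g v : R.
Hypothesis v1 : 1 <= v.
Hypothesis g1 : `|g| <= 1.

Let q t := Num.sqrt (v + 1 - t * t).
Let z t := (y + g * t) / q t.
(** [K 0] is one hinge's heat term at [y] with variance [v + 1], and [K 1] the term at [y + g] with
    variance [v]. [K1] and [K2] are the derivatives in [t]. *)
Let K t := q t * gcdf_int (z t).
Let K1 t := g * gcdf (z t) - t / q t * gpdf (z t).
Let K2 t := gpdf (z t) / q t *
  (g * g - 1 + 2 * g * t * z t / q t + t * t * (z t * z t - 1) / (q t * q t)).

Let sqr_le1 t : 0 <= t <= 1 -> t * t <= 1.
Proof. by move=> /andP[t0 t1]; rewrite mulr_ile1. Qed.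

Let qq t : 0 <= t <= 1 -> v <= q t * q t.
Proof.
move=> /sqr_le1 t1; rewrite -[_ * _]expr2 sqr_sqrtr; last by move: v1; lra.
by lra.
Qed.

Let q_gt0 t : 0 <= t <= 1 -> 0 < q t.
Proof. by move=> /sqr_le1 t1; rewrite sqrtr_gt0; move: v1; lra. Qed.

Let q_ge1 t : 0 <= t <= 1 -> 1 <= q t.
Proof.
by move=> /sqr_le1 t1; rewrite -[leLHS]sqrtr1 ler_sqrt; move: v1; lra.
Qed.

Let dq t : 0 <= t <= 1 -> is_derive t 1 q (- t / q t).
Proof.
move=> t01; have q0 := q_gt0 t t01.
rewrite /q; isder_eq ltac:(apply: is_derive1_sqrt; rewrite -sqrtr_gt0 //).
by rewrite -/(q t); field; rewrite gt_eqF.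
Qed.

Let dz t : 0 <= t <= 1 -> is_derive t 1 z (g / q t + t * z t / (q t * q t)).
Proof.
move=> t01; have q0 := q_gt0 t t01; have qd := dq t t01.
rewrite /z; isder_eq ltac:(exact: qd); first by rewrite gt_eqF.
by field; rewrite gt_eqF.
Qed.

Let dK t : 0 <= t <= 1 -> is_derive t 1 K (K1 t).
Proof.
move=> t01; have q0 := q_gt0 t t01; have qd := dq t t01; have zd := dz t t01.
rewrite /K; isder_eq ltac:(first [exact: qd|exact: zd|exact: is_derive_gcdf_int]).
by rewrite /K1 /gcdf_int; field; rewrite gt_eqF.
Qed.

Let dK1 t : 0 <= t <= 1 -> is_derive t 1 K1 (K2 t).
Proof.
move=> t01; have q0 := q_gt0 t t01; have qd := dq t t01; have zd := dz t t01.
rewrite /K1; isder_eq ltac:(first [exact: qd|exact: zd|exact: is_derive_gcdf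
  |exact: is_derive_gpdf]); first by rewrite gt_eqF.
by rewrite /K2; field; rewrite gt_eqF.
Qed.

Let K2_bound t : 0 <= t <= 1 ->
  `|K2 t - gpdf (z t) / q t * (g * g - 1)| <= 6 / v.
Proof.
move=> t01; have q1 := q_ge1 t t01; have qv := qq t t01.
have q0 : 0 < q t by lra.
have -> : K2 t - gpdf (z t) / q t * (g * g - 1) =
    (2 * g * t * (z t * gpdf (z t))
     + t * t / q t * (z t * z t * gpdf (z t) - gpdf (z t))) / (q t * q t).
  by rewrite /K2; field; rewrite gt_eqF.
rewrite normrM [`|(_ * _)^-1|]gtr0_norm ?invr_gt0 ?mulr_gt0//.
have qq0 : 0 < q t * q t by rewrite mulr_gt0.
apply: ler_pM => //; [by rewrite invr_ge0 ltW| |]; last first.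
  by rewrite lef_pV2 ?posrE//; move: v1; lra.
apply: le_trans (ler_normD _ _) _.
(* The product 4 bounds [2 * g * t] times [z * gpdf z]. The other 2 bounds
   [z * z * gpdf z - gpdf z], which lies between -1 and 2. *)
rewrite (_ : 6 = 2 * 2 + 2); last by ring.
case/andP: t01 => t0 t1; apply: lerD.
  rewrite normrM; apply: ler_pM => //.
    rewrite -mulrA normrM ger0_norm// ler_piMr//.
    by rewrite normrM mulr_ile1// ger0_norm.
  by rewrite normrM (gtr0_norm (gpdf_gt0 _)) norm_gpdf_le.
rewrite normrM -[leRHS]mul1r; apply: ler_pM => //.
  rewrite ger0_norm; last by rewrite divr_ge0 ?mulr_ge0 ?(ltW q0).
  by rewrite ler_pdivrMr// mul1r; apply: le_trans q1; rewrite mulr_ile1.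
have := sqr_gpdf_le (z t); have := gpdf_gt0 (z t).
have := @gpdf_le1 R (z t).
have : 0 <= z t * z t by rewrite -expr2 sqr_ge0.
move=> zz gl g0 H; rewrite ler_norml.
have : 0 <= z t * z t * gpdf (z t) by rewrite mulr_ge0// ltW.
lra.
Qed.

Lemma heat_step_le :
  Num.sqrt v * gcdf_int ((y + g) / Num.sqrt v) <=
  Num.sqrt (v + 1) * gcdf_int (y / Num.sqrt (v + 1))
  + g * gcdf (y / Num.sqrt (v + 1)) + 6 / v.
Proof.
have c0 : 0 <= 6 / v by rewrite divr_ge0//; move: v1; lra.
have := taylor2_le _ _ _ _ c0 dK dK1; rewrite /K /K1 /z /q.
rewrite !mulr1 !mulr0 !addr0 !subr0 !mul0r subr0 addrK; apply.
move=> t t01; have := K2_bound t t01; rewrite ler_norml => /andP[_ H].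
have : gpdf (z t) / q t * (g * g - 1) <= 0.
  apply: mulr_ge0_le0; first by rewrite divr_ge0// ltW ?gpdf_gt0 ?q_gt0.
  have gg0 : 0 <= g * g by rewrite -expr2 sqr_ge0.
  by rewrite subr_le0 -(ger0_norm gg0) normrM mulr_ile1.
by move: H; rewrite -/(K2 t); lra.
Qed.

(** For unit outcomes the drift vanishes, so the expansion also holds from below. *)
Lemma heat_step_ge : g * g = 1 ->
  Num.sqrt (v + 1) * gcdf_int (y / Num.sqrt (v + 1))
  + g * gcdf (y / Num.sqrt (v + 1)) - 6 / v <=
  Num.sqrt v * gcdf_int ((y + g) / Num.sqrt v).
Proof.
move=> gg; have c0 : 0 <= 6 / v by rewrite divr_ge0//; move: v1; lra.
have d1 t : 0 <= t <= 1 -> is_derive t 1 (fun t => - K t) (- K1 t).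
  by move=> t01; exact: is_derive_fun_opp (dK t t01).
have d2 t : 0 <= t <= 1 -> is_derive t 1 (fun t => - K1 t) (- K2 t).
  by move=> t01; exact: is_derive_fun_opp (dK1 t t01).
suff : - K 1 <= - K 0 + - K1 0 + 6 / v.
  rewrite /K /K1 /z /q.
  by rewrite !mulr1 !mulr0 !addr0 !subr0 !mul0r subr0 addrK; lra.
apply: (taylor2_le (fun t => - K t) (fun t => - K1 t) (fun t => - K2 t)) => // t t01.
have := K2_bound t t01; rewrite gg subrr mulr0 subr0 ler_norml; lra.
Qed.

End Path.

End HeatStep.

(** * Shape and one-round change of the two-hinge potential *)

Section TwoHingesPotential.
Context {R : realType}.
Implicit Types (a A b s g v q x y t : R).

Let hinge_ge y : y <= Num.max y 0.
Proof. by rewrite le_max lexx. Qed.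

Let hinge_ge0 y : 0 <= Num.max y 0.
Proof. by rewrite le_max lexx orbT. Qed.

Lemma two_hinges_convex a A : convex_function setT (two_hinges a A).
Proof.
move=> t x y _ _.
have -> : conv t x y = t%:num * x + (1 - t%:num) * y :> R by exact: convRE.
rewrite convRE /two_hinges /unstable.onem.
have t0 : 0 <= t%:num by [].
have t1 : 0 <= 1 - t%:num by rewrite subr_ge0.
move: (t%:num) t0 t1 => {}t t0 t1.
have key u v : Num.max (t * u + (1 - t) * v) 0 <=
    t * Num.max u 0 + (1 - t) * Num.max v 0.
  rewrite ge_max; apply/andP; split.
    by apply: lerD; apply: ler_wpM2l => //; exact: hinge_ge.
  by apply: addr_ge0; apply: mulr_ge0.
have := key (x - a) (y - a); have := key (- x - a) (- y - a).
have -> : t * (x - a) + (1 - t) * (y - a) = t * x + (1 - t) * y - a by ring.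
have -> : t * (- x - a) + (1 - t) * (- y - a) = - (t * x + (1 - t) * y) - a by ring.
lra.
Qed.

(** Since [a >= 0], the two hinges are never active together, so the slope stays between -1 and
    1. *)
Lemma two_hinges_lipschitz a A : 0 <= a -> 1.-lipschitz (two_hinges a A).
Proof.
move=> a0 [x y] _ /=; rewrite mul1r /two_hinges.
rewrite !maxEle ler_norml; have := ler_norm (x - y); have := ler_norm (- (x - y)).
rewrite normrN.
case: (leP (x - a) 0) => ?; case: (leP (- x - a) 0) => ?;
  case: (leP (y - a) 0) => ?; case: (leP (- y - a) 0) => ? ? ?;
  apply/andP; split; lra.
Qed.

(** Read off at the end of the game: the first bound controls the loss, the second the loss plus
    [|s|], which is the regret. *)
Lemma two_hinges_ge a A s : - A <= two_hinges a A s /\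
  `|s| - a - A <= two_hinges a A s.
Proof.
rewrite /two_hinges; have := hinge_ge (s - a); have := hinge_ge (- s - a).
have := hinge_ge0 (s - a); have := hinge_ge0 (- s - a).
by split; [lra|case: ger0P => _; lra].
Qed.

Lemma two_hingesE a A s : 0 <= a ->
  two_hinges a A s = Num.max (`|s| - a) 0 - A.
Proof.
move=> a0; rewrite /two_hinges; congr (_ - _).
case: (ger0P s) => s0.
  by rewrite [X in _ + X](max_idPr _) ?addr0//; lra.
by rewrite [X in X + _](max_idPr _) ?add0r//; lra.
Qed.

(** One unit of variance is left after the last round; smoothing by it costs at most [gcdf_int 0]
    per hinge. *)
Lemma two_hinges_heat1 a A s :
  two_hinges a A s <= two_hinges_heat a A s 1 <= two_hinges a A s + 2 * gcdf_int 0.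
Proof.
rewrite /two_hinges /two_hinges_heat !divr1 !mul1r.
have := gcdf_int_ge_pos (s - a); have := gcdf_int_ge_pos (- s - a).
have := gcdf_int_le_pos (s - a); have := gcdf_int_le_pos (- s - a).
lra.
Qed.

(** The tangent inequality at [q] for [q * gcdf_int (y / q)], which is convex in [q] with derivative
    [gpdf (y / q)]. *)
Let scaled_le y q q' : 0 < q -> 0 < q' ->
  q * gcdf_int (y / q) <= q' * gcdf_int (y / q') + (q - q') * gpdf (y / q).
Proof.
move=> q0 q0'; have := gcdf_int_tangent (y / q) (y / q').
rewrite -(ler_pM2l q0') => /(le_trans _) H; rewrite -lerBlDr; apply: H.
rewrite /gcdf_int le_eqVlt; apply/orP; left; apply/eqP; field.
by rewrite !gt_eqF.
Qed.

(** The two square roots differ by at most 1 and the density is at most 1, so each hinge changes by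
    at most 1. *)
Lemma two_hinges_heat_sqrtS a A s (T : nat) : (1 <= T)%N ->
  two_hinges_heat a A s (Num.sqrt T%:R) <=
  two_hinges_heat a A s (Num.sqrt (T%:R + 1)) <=
  two_hinges_heat a A s (Num.sqrt T%:R) + 2.
Proof.
move=> T1; rewrite /two_hinges_heat.
set q' := Num.sqrt T%:R; set q := Num.sqrt (T%:R + 1).
have T0 : 0 < (T%:R : R) by rewrite ltr0n.
have q0' : 0 < q' by rewrite sqrtr_gt0.
have q0 : 0 < q by rewrite sqrtr_gt0; lra.
have qq' : 0 <= q - q' by rewrite subr_ge0 ler_sqrt; lra.
have qq1 : q - q' <= 1.
  have : q * q = q' * q' + 1 by rewrite -!expr2 !sqr_sqrtr; lra.
  by move=> H; rewrite leNgt; apply/negP => H1; nra.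
have bnd z : 0 <= (q - q') * gpdf z <= 1.
  have := gpdf_gt0 z; have := gpdf_le1 z => g1 g0.
  by apply/andP; split; [rewrite mulr_ge0// ltW|rewrite mulr_ile1// ltW].
have bndN z : (q' - q) * gpdf z <= 0 by have := bnd z; lra.
have := scaled_le (s - a) _ _ q0 q0'; have := scaled_le (s - a) _ _ q0' q0.
have := scaled_le (- s - a) _ _ q0 q0'; have := scaled_le (- s - a) _ _ q0' q0.
have := bnd ((s - a) / q); have := bnd ((- s - a) / q).
have := bndN ((s - a) / q'); have := bndN ((- s - a) / q').
lra.
Qed.

Lemma two_hinges_step_le a A s g v : 1 <= v -> `|g| <= 1 ->
  two_hinges_heat a A (s + g) (Num.sqrt v) <=
  two_hinges_heat a A s (Num.sqrt (v + 1))
  + g * two_hinges_slope a s (Num.sqrt (v + 1)) + 12 / v.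
Proof.
move=> v1 g1; have Ng1 : `|- g| <= 1 by rewrite normrN.
have := heat_step_le (s - a) g v v1 g1; have := heat_step_le (- s - a) (- g) v v1 Ng1.
have -> : s - a + g = s + g - a by ring.
have -> : - s - a - g = - (s + g) - a by ring.
have -> : 12 / v = 6 / v + 6 / v by ring.
rewrite /two_hinges_heat /two_hinges_slope; lra.
Qed.

Lemma two_hinges_step_ge a A s g v : 1 <= v -> g * g = 1 ->
  two_hinges_heat a A s (Num.sqrt (v + 1))
  + g * two_hinges_slope a s (Num.sqrt (v + 1)) - 12 / v <=
  two_hinges_heat a A (s + g) (Num.sqrt v).
Proof.
move=> v1 g1; have Ng1 : (- g) * (- g) = 1 by rewrite mulrNN.
have n1 : `|g| <= 1 by rewrite -(@ler_pXn2r _ 2)// ?nnegrE// expr1n -normrX expr2 g1 normr1.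
have Nn1 : `|- g| <= 1 by rewrite normrN.
have := heat_step_ge (s - a) g v v1 n1 g1.
have := heat_step_ge (- s - a) (- g) v v1 Nn1 Ng1.
have -> : s - a + g = s + g - a by ring.
have -> : - s - a - g = - (s + g) - a by ring.
have -> : 12 / v = 6 / v + 6 / v by ring.
rewrite /two_hinges_heat /two_hinges_slope; lra.
Qed.

Lemma harmonic_sum_le (T : nat) : (1 <= T)%N ->
  \sum_(i < T) ((T - i)%:R : R)^-1 <= 1 + ln T%:R.
Proof.
have -> : \sum_(i < T) ((T - i)%:R : R)^-1 = \sum_(i < T) (i.+1%:R)^-1.
  rewrite (reindex_inj rev_ord_inj)/=; apply: eq_bigr => i _.
  by rewrite subKn.
case: T => // n _; elim: n => [|n IH].
  by rewrite big_ord_recr big_ord0/= add0r invr1 ln1 addr0.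
rewrite big_ord_recr/=.
have n0 : 0 < (n.+1%:R : R) by rewrite ltr0n.
have m0 : 0 < (n.+2%:R : R) by rewrite ltr0n.
have E : (n.+2%:R : R) = n.+1%:R + 1 by rewrite -natr1.
apply: (le_trans (lerD IH (lexx _))); rewrite -addrA lerD2l -lerBrDl.
(* The inequality [ln (1 + x) <= x] at [x = - 1 / (n + 2)] gives
   [1 / (n + 2) <= ln ((n + 2) / (n + 1))]. *)
have lt1 : -1 < - (n.+2%:R : R)^-1.
  by rewrite ltrN2 invf_lt1// E ltrDr.
have := le_ln1Dx lt1.
have -> : 1 - (n.+2%:R : R)^-1 = n.+1%:R / n.+2%:R.
  have -> : (n.+1%:R : R) = n.+2%:R - 1 by rewrite E addrK.
  by rewrite mulrBl divff ?mul1r// gt_eqF.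
rewrite ln_div ?posrE//; move: (ln _) (ln _) (n.+2%:R^-1) => l1 l2 i; lra.
Qed.

End TwoHingesPotential.

(** * The two strategies *)

Section Game.
Context {R : realType}.
Implicit Types (a A b s g v x : R) (alg adv : seq R -> R).

Definition net (p : seq (R * R)) : R := \sum_(i <- p) i.2.
Definition cost (p : seq (R * R)) : R := \sum_(i <- p) i.2 * i.1.

Lemma size_play alg adv t : size (play alg adv t) = t.
Proof. by elim: t => //= t IH; rewrite size_rcons IH. Qed.

Lemma net_rcons p i : net (rcons p i) = net p + i.2.
Proof. by rewrite /net big_rcons. Qed.

Lemma cost_rcons p i : cost (rcons p i) = cost p + i.2 * i.1.
Proof. by rewrite /cost big_rcons. Qed.

Lemma sum_unzip2 p : \sum_(g <- unzip2 p) g = net p.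
Proof. by rewrite big_map. Qed.

Lemma play_sub alg adv t t' : (t <= t')%N ->
  {subset play alg adv t <= play alg adv t'}.
Proof.
move=> /subnK <-; elim: (t' - t)%N => // n IH p /IH; rewrite addSn /= mem_rcons.
by rewrite in_cons => ->; rewrite orbT.
Qed.

Lemma Regret_unifE T alg adv :
  Regret_unif T alg adv = Loss T alg adv + `|net (play alg adv T)|.
Proof.
rewrite /Regret_unif /Loss; set p := play _ _ _; rewrite -/(cost p).
have E u : \sum_(i <- p) i.2 * (i.1 - u) = cost p - u * net p.
  rewrite /cost /net mulr_sumr -sumrB; apply: eq_bigr => i _; ring.
have ub : ubound [set \sum_(i <- p) i.2 * (i.1 - u) | u in `[-1, 1]]
    (cost p + `|net p|).
  move=> _ [u + <-]; rewrite /= in_itv/= => u1; rewrite E lerD2l.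
  rewrite (le_trans (ler_norm _))// normrN normrM ler_piMl//.
  by rewrite ler_norml.
apply/eqP; rewrite eq_le; apply/andP; split.
  apply: (ge_sup _ ub); exists (\sum_(i <- p) i.2 * (i.1 - 0)).
  by exists 0 => //=; rewrite in_itv/=; lra.
apply: ub_le_sup; first by exists (cost p + `|net p|).
(* The best comparator opposes the sign of the total outcome. *)
exists (if 0 <= net p then -1 else 1); last first.
  by rewrite E; case: ger0P => _; ring.
by rewrite /= in_itv/=; case: ifP => _; lra.
Qed.

(* Round [t] (with [t - 1] earlier outcomes) is played with variance budget
   [T - t + 1], so one unit is spent per round and one unit is kept. *)
Definition stein_rho (T : nat) (gs : seq R) : R := Num.sqrt (T - size gs)%:R.

Lemma natr_subS (T n : nat) : (n < T)%N ->
  ((T - n)%:R : R) = (T - n.+1)%:R + 1.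
Proof. by move=> nT; rewrite natr1 -subSn. Qed.

Lemma stein_rho_admissible (T : nat) :
  admissible T (Num.sqrt (T%:R + 1)) (stein_rho T).
Proof.
split; first by rewrite sqrtr_gt0 ltr_pwDr.
case=> // t gs /andP[_ tT] /= sgs.
rewrite /rho_at /stein_rho !size_take sgs ltnn; split; last first.
  by move=> _; rewrite sqrtr_gt0 ltr0n subn_gt0.
rewrite sqrtr_ge0/=; case: t tT sgs => [|t] tT sgs.
  by rewrite subn0 ler_sqrt ?lerDl// addr_ge0.
by rewrite size_take sgs ltnSn ler_sqrt// ler_nat leq_sub2l.
Qed.

Lemma stein_algE a A (T : nat) (gs : seq R) : (size gs < T)%N ->
  stein_alg (two_hinges a A) (Num.sqrt (T%:R + 1)) (stein_rho T) gs =
  gaussE (fun z => stein_two_hinges a (\sum_(g <- gs) g)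
      (Num.sqrt ((T - size gs)%:R + 1))
      (\sum_(g <- gs) g + Num.sqrt (T - size gs)%:R * z)).
Proof.
move=> gT; rewrite /stein_alg /=.
have -> : rho_at (Num.sqrt (T%:R + 1)) (stein_rho T) (size gs) gs =
    Num.sqrt ((T - size gs)%:R + 1).
  rewrite /rho_at; case E: (size gs) gT => [|n] nT.
    by rewrite subn0.
  by rewrite /stein_rho size_take E ltnSn (natr_subS _ _ (ltnW nT)).
by rewrite /stein_rho size_take ltnn stein_sol_two_hinges.
Qed.

Let tail_ge1 (T n : nat) : (n < T)%N -> 1 <= ((T - n)%:R : R).
Proof. by move=> nT; rewrite ler1n subn_gt0. Qed.

(** Error of one round: 6 for the heat step of each hinge, plus the deviation of the move from minus
    the slope. *)
Definition round_const : R := 12 + stein_move_const.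

(** Cost plus heat potential rises in each round by at most [round_const] over the remaining
    variance, because the move cancels the first-order term of [two_hinges_step_le]. *)
Lemma stein_alg_potential a A (T : nat) adv t :
    let alg := stein_alg (two_hinges a A) (Num.sqrt (T%:R + 1)) (stein_rho T) in
    bounded_adv T alg adv -> (t <= T)%N ->
  cost (play alg adv t)
    + two_hinges_heat a A (net (play alg adv t)) (Num.sqrt ((T - t)%:R + 1))
  <= two_hinges_heat a A 0 (Num.sqrt (T%:R + 1))
    + round_const * \sum_(i < t) ((T - i)%:R)^-1.
Proof.
move=> alg badv; elim: t => [|t IH] tT.
  by rewrite /cost /net !big_nil subn0 big_ord0 mulr0 addr0 add0r.
have := IH (ltnW tT); rewrite /= big_ord_recr/=.
set p := play alg adv t; set x := alg _; set g := adv _.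
have /badv : (x, g) \in play alg adv T.
  by apply: play_sub tT _ _; rewrite /= mem_rcons in_cons eqxx.
rewrite /= => g1; have {}g1 : `|g| <= 1 by rewrite ler_norml.
rewrite cost_rcons net_rcons /= => IHt.
set v : R := (T - t)%:R in IHt *.
have v1 : 1 <= v by exact: tail_ge1.
rewrite -(natr_subS _ _ tT) -/v.
have sq0 : size (unzip2 p) = t by rewrite size_map size_play.
have := two_hinges_step_le a A (net p) g v v1 g1.
have v0 : 0 < v by lra.
have xE : `|x + two_hinges_slope a (net p) (Num.sqrt (v + 1))|
    <= stein_move_const / v.
  rewrite /x /alg stein_algE sq0// sum_unzip2 -/v.
  apply: (le_trans (stein_move_slope _ _ _ _ _ _ _)).
  - by rewrite sqrtr_gt0; lra.
  - exact: sqrtr_ge0.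
  - by rewrite !sqr_sqrtr; lra.
  rewrite sqr_sqrtr; last lra.
  rewrite ler_wpM2l ?stein_move_const_ge0// lef_pV2 ?posrE//; lra.
have gx : g * x <= - (g * two_hinges_slope a (net p) (Num.sqrt (v + 1)))
    + stein_move_const / v.
  rewrite -lerBlDl opprK -mulrDr (le_trans (ler_norm _))// normrM.
  apply: le_trans xE; rewrite ler_piMl//.
move: IHt gx; move: (\sum_(i < t) _) => S.
have -> : round_const * (S + v^-1) =
    round_const * S + 12 / v + stein_move_const / v by rewrite /round_const; ring.
lra.
Qed.

Lemma stein_alg_range a A (T : nat) :
  is_olo_alg T (stein_alg (two_hinges a A) (Num.sqrt (T%:R + 1)) (stein_rho T)).
Proof.
by move=> gs gT; rewrite stein_algE//; exact: gaussE_stein_two_hinges_range.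
Qed.

(** The round errors, the smoothing left at the end, and the passage from variance [T + 1] to [T] at
    the start. *)
Definition olo_const : R := round_const + 2 * gcdf_int 0 + 2.

Lemma olo_const_ge0 : 0 <= olo_const.
Proof.
rewrite /olo_const /round_const; have := @stein_move_const_ge0 R.
have := @gcdf_int_gt0 R 0; lra.
Qed.

Lemma two_hinges_heat_sqrt0 b (T : nat) : (1 <= T)%N ->
  two_hinges_heat (b * Num.sqrt T%:R) (2 * gcdf_int (- b) * Num.sqrt T%:R) 0
    (Num.sqrt T%:R) = 0.
Proof.
move=> T1; have s0 : 0 < Num.sqrt (T%:R : R) by rewrite sqrtr_gt0 ltr0n.
rewrite /two_hinges_heat oppr0 !sub0r.
have -> : - (b * Num.sqrt T%:R) / Num.sqrt T%:R = - b.
  by field; rewrite gt_eqF.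
by ring.
Qed.

Lemma stein_alg_guarantee b (T : nat) adv : (1 <= T)%N ->
    let alg := stein_alg
      (two_hinges (b * Num.sqrt T%:R) (2 * gcdf_int (- b) * Num.sqrt T%:R))
      (Num.sqrt (T%:R + 1)) (stein_rho T) in
    bounded_adv T alg adv ->
  Loss T alg adv <= 2 * gcdf_int (- b) * Num.sqrt T%:R + olo_const * (1 + ln T%:R) /\
  Regret_unif T alg adv <=
    (b + 2 * gcdf_int (- b)) * Num.sqrt T%:R + olo_const * (1 + ln T%:R).
Proof.
move=> T1 alg badv; rewrite Regret_unifE /Loss -/(cost _).
have := stein_alg_potential _ _ _ _ T badv (leqnn T).
rewrite -/alg subnn add0r sqrtr1.
set p := play _ _ _; set a := b * _; set A := 2 * _ * _.
have := two_hinges_heat1 a A (net p).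
have [] := two_hinges_ge a A (net p).
have := two_hinges_heat_sqrtS a A 0 T T1; rewrite two_hinges_heat_sqrt0//.
have l0 : 0 <= ln (T%:R : R) by rewrite ln_ge0// ler1n.
have hs := @harmonic_sum_le R T T1.
have c0 : 0 <= round_const.
  by rewrite /round_const; have := @stein_move_const_ge0 R; lra.
have : round_const * \sum_(i < T) ((T - i)%:R)^-1 <= round_const * (1 + ln T%:R).
  exact: ler_wpM2l.
have -> : olo_const * (1 + ln T%:R) = round_const * (1 + ln T%:R)
    + (2 * gcdf_int 0 + 2) * (1 + ln T%:R) by rewrite /olo_const; ring.
have : 2 <= (2 * gcdf_int 0 + 2) * (1 + ln (T%:R : R)).
  have := @gcdf_int_gt0 R 0 => g0; rewrite -[leLHS]mulr1; apply: ler_pM => //; lra.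
have -> : (b + 2 * gcdf_int (- b)) * Num.sqrt T%:R = a + A by rewrite /a /A; ring.
move: (round_const * \sum_(i < _) _) (round_const * (1 + _)) (_ * (1 + _)).
by move=> *; split; lra.
Qed.

(* The adversary answers with the sign that keeps cost plus potential largest;
   the average over both signs already does not decrease, whatever [x] is. *)
Definition greedy_sign a (T n : nat) s x : R :=
  let q := Num.sqrt (T - n)%:R in
  if x + two_hinges_heat a 0 (s + 1) q < - x + two_hinges_heat a 0 (s - 1) q
  then -1 else 1.

(** An adversary sees only the moves, so it recomputes its own answers by a fold. The state holds
    the number of rounds, the running sum of outcomes and the last answer. *)
Definition greedy_step a (T : nat) (st : nat * R * R) x : nat * R * R :=
  let g := greedy_sign a T st.1.1 st.1.2 x in (st.1.1.+1, st.1.2 + g, g).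

Definition greedy_adv a (T : nat) (xs : seq R) : R :=
  (foldl (greedy_step a T) (0%N, 0, 0) xs).2.

Lemma greedy_state a (T : nat) alg t :
  let p := play alg (greedy_adv a T) t in
  (foldl (greedy_step a T) (0%N, 0, 0) (unzip1 p)).1 = (t, net p).
Proof.
elim: t => [|t IH] /=; first by rewrite /net big_nil.
rewrite /unzip1 map_rcons foldl_rcons net_rcons /=.
rewrite /greedy_adv foldl_rcons /greedy_step /=.
by rewrite /unzip1 in IH; rewrite IH.
Qed.

Lemma greedy_advE a (T : nat) alg t (x : R) :
  let p := play alg (greedy_adv a T) t in
  greedy_adv a T (rcons (unzip1 p) x) = greedy_sign a T t (net p) x.
Proof. by move=> p; rewrite /greedy_adv foldl_rcons /= greedy_state. Qed.

Lemma greedy_adv_bounded a (T : nat) alg : bounded_adv T alg (greedy_adv a T).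
Proof.
suff H t p : p \in play alg (greedy_adv a T) t -> -1 <= p.2 <= 1 by exact: H.
elim: t p => // t IH p /=; rewrite mem_rcons in_cons.
case/predU1P => [->|/IH//]; rewrite /= greedy_advE /greedy_sign.
by case: ifP => _; lra.
Qed.

Lemma greedy_potential a (T : nat) alg t : (t <= T)%N ->
  two_hinges_heat a 0 0 (Num.sqrt (T%:R + 1))
    - 12 * \sum_(i < t) ((T - i)%:R)^-1 <=
  cost (play alg (greedy_adv a T) t)
    + two_hinges_heat a 0 (net (play alg (greedy_adv a T) t))
        (Num.sqrt ((T - t)%:R + 1)).
Proof.
elim: t => [|t IH] tT.
  by rewrite /cost /net !big_nil subn0 big_ord0 mulr0 subr0 add0r.
have := IH (ltnW tT); rewrite /= big_ord_recr/=.
set p := play alg _ t; set x := alg _ => IHt.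
rewrite cost_rcons net_rcons greedy_advE -/p -(natr_subS _ _ tT) /greedy_sign.
set v : R := (T - t)%:R in IHt *.
have v1 : 1 <= v by exact: tail_ge1.
have := two_hinges_step_ge a 0 (net p) 1 v v1 (ltac:(ring)).
have := two_hinges_step_ge a 0 (net p) (-1) v v1 (ltac:(ring)).
move: IHt; move: (\sum_(i < t) _) => S IHt.
have -> : 12 * (S + v^-1) = 12 * S + 12 / v by ring.
by case: ltP => /=; lra.
Qed.

(** The trade-off behind the lower bound: a small loss forces [|s_T|] beyond the kink, and then loss
    plus [|s_T|], the regret, is large. *)
Lemma greedy_guarantee b (T : nat) alg : 0 <= b -> (1 <= T)%N ->
  2 * gcdf_int (- b) * Num.sqrt T%:R - olo_const * (1 + ln T%:R) <=
  Loss T alg (greedy_adv (b * Num.sqrt T%:R) T)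
    + Num.max (`|net (play alg (greedy_adv (b * Num.sqrt T%:R) T) T)|
               - b * Num.sqrt T%:R) 0.
Proof.
move=> b0 T1; rewrite /Loss -/(cost _); set a := b * _.
have a0 : 0 <= a by rewrite mulr_ge0.
have := greedy_potential a T alg T (leqnn T); rewrite subnn add0r sqrtr1.
set p := play _ _ _; have := two_hinges_heat1 a 0 (net p).
rewrite two_hingesE// subr0.
have := two_hinges_heat_sqrtS a 0 0 T T1.
have : two_hinges_heat a 0 0 (Num.sqrt T%:R) = 2 * gcdf_int (- b) * Num.sqrt T%:R.
  have := two_hinges_heat_sqrt0 b T T1; rewrite -/a /two_hinges_heat; lra.
move=> ->.
have l0 : 0 <= ln (T%:R : R) by rewrite ln_ge0// ler1n.
have hs := @harmonic_sum_le R T T1.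
have : 12 * \sum_(i < T) ((T - i)%:R)^-1 <= 12 * (1 + ln (T%:R : R)).
  exact: ler_wpM2l.
have -> : olo_const * (1 + ln T%:R) = 12 * (1 + ln T%:R)
    + (stein_move_const + 2) * (1 + ln T%:R) + 2 * gcdf_int 0 * (1 + ln T%:R).
  by rewrite /olo_const /round_const; ring.
have m0 := @stein_move_const_ge0 R; have g0 := @gcdf_int_gt0 R 0.
have : 0 <= (stein_move_const + 2) * (1 + ln (T%:R : R)) by rewrite mulr_ge0; lra.
have : 2 * gcdf_int 0 <= 2 * gcdf_int 0 * (1 + ln (T%:R : R)).
  by rewrite ler_peMr; lra.
move: (12 * \sum_(i < _) _) (12 * (1 + _)) (_ * (1 + _)) (_ * (1 + _)).
by move=> *; lra.
Qed.

End Game.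

(** * The limit *)

Section Asymptotics.
Context {R : realType}.
Implicit Types (c eps eta y : R).

(** The upper limit on [eps] is exactly [2 * gcdf_int 0], so the intermediate value theorem yields a
    root [y <= 0], that is, a kink [- y >= 0]. *)
Lemma gcdf_int_surj eps : 0 < eps -> eps <= Num.sqrt (2 / pi) ->
  exists2 y : R, y <= 0 & 2 * gcdf_int y = eps.
Proof.
move=> e0 e1; have h0 : 0 < eps / 2 by rewrite divr_gt0.
have psi0 : eps <= 2 * gcdf_int 0.
  apply: (le_trans e1); rewrite /gcdf_int mul0r add0r gpdf0.
  have pi0 : 0 < (pi : R) by exact: pi_gt0.
  rewrite ler_pdivlMr ?sqrtr_gt0 ?mulr_gt0// -sqrtrM ?divr_ge0 ?(ltW pi0)//.
  have -> : 2 / pi * (2 * pi) = 2 ^+ 2 :> R.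
    by rewrite mulrACA mulVf ?mulr1// gt_eqF.
  by rewrite sqrtr_sqr ger0_norm.
have [y0 [y00 y0e]] : exists y0 : R, y0 <= 0 /\ gcdf_int y0 <= eps / 2.
  have H1 : \forall t \near -oo, gcdf_int t <= eps / 2.
    by apply: cvgr_le h0; exact: gcdf_int_cvgNy.
  have H2 := @nbhs_ninfty_le R 0 (num_real 0).
  by have [y0 []] := filter_ex (filterI H1 H2); exists y0.
have cpsi : {within `[y0, 0], continuous (@gcdf_int R)}.
  exact/continuous_subspaceT/(derivable_continuous _ _ is_derive_gcdf_int).
have [|y] := IVT y00 cpsi (v := eps / 2).
  have psi0' : eps / 2 <= gcdf_int 0 by lra.
  by rewrite ge_min y0e/= le_max psi0' orbT.
rewrite in_itv/= => /andP[_ y_le0] E; exists y => //.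
by rewrite E; field.
Qed.

Lemma gamma_equationE eps c : gamma_equation eps c <-> 2 * gcdf_int (eps - c) = eps.
Proof.
rewrite /gamma_equation integral_std_normal_cdf; split=> [[] -> | H].
  by field.
by congr EFin; rewrite -[in RHS]H; field.
Qed.

Lemma gcdf_int_inj : injective (@gcdf_int R).
Proof.
move=> x y E; apply/eqP; rewrite eq_le !leNgt.
by apply/andP; split; apply/negP => /gcdf_int_lt; rewrite E ltxx.
Qed.

(** With [r] the fourth root of [T], [ln T = 4 * ln r <= 4 * r]. Hence for [r >= 1] the left side is
    at most [5 * C * r], which is below [d * r ^+ 2] once [r >= M]. *)
Lemma near_log_le_sqrt (C d : R) : 0 <= C -> 0 < d ->
  \forall T \near \oo, C * (1 + ln T%:R) <= d * Num.sqrt T%:R.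
Proof.
move=> C0 d0; pose M := 1 + 5 * C / d.
have M1 : 1 <= M by rewrite lerDl divr_ge0 ?(ltW d0)// mulr_ge0.
near=> T.
have TM : M * M * (M * M) <= T%:R by near: T; exact: nbhs_infty_ger.
have MM : 1 <= M * M by exact: mulr_ege1.
have T1 : 1 <= (T%:R : R).
  by apply: le_trans TM; exact: mulr_ege1.
pose r := Num.sqrt (Num.sqrt (T%:R : R)).
have r0 : 0 < r by rewrite !sqrtr_gt0; lra.
have rr : Num.sqrt (T%:R : R) = r * r by rewrite -expr2 sqr_sqrtr.
have rrrr : (T%:R : R) = (r * r) * (r * r) by rewrite -rr -expr2 sqr_sqrtr//; lra.
have rM : M <= r.
  rewrite /r -[leLHS]ger0_norm; last lra.
  rewrite -sqrtr_sqr ler_wsqrtr// expr2 -[leLHS]ger0_norm; last lra.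
  by rewrite -sqrtr_sqr ler_wsqrtr// expr2.
have lnT : ln (T%:R : R) <= 4 * r.
  rewrite rrrr !lnM ?posrE ?mulr_gt0//.
  have := ln_sublinear r0; lra.
rewrite rr.
have dM : 5 * C <= d * M.
  have -> : d * M = d + 5 * C by rewrite /M; field; rewrite gt_eqF.
  lra.
have r1 : 1 <= r by lra.
have h1 : C * (1 + ln T%:R) <= C * (5 * r) by apply: ler_wpM2l => //; lra.
have h2 : C * (5 * r) <= d * M * r by rewrite mulrA [C * 5]mulrC ler_wpM2r// ltW.
apply: (le_trans h1); apply: (le_trans h2).
by rewrite -mulrA ler_wpM2l ?(ltW d0)// ler_wpM2r// ltW.
Unshelve. all: by end_near. Qed.

Section Eps.
Variables eps y : R.
Hypothesis y0 : y <= 0.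
Hypothesis psiy : 2 * gcdf_int y = eps.

Let b := - y.
Let c := eps - y.

(** The loss constraint is exact and leaves no room for a logarithm. A kink [b'] slightly beyond [b]
    lowers the loss by a multiple of [sqrt T] that absorbs it, and raises the regret constant by at
    most [eta / 2]. *)
Lemma near_opt_Regret_le eta : 0 < eta ->
  \forall T \near \oo, (opt_Regret_unif eps T <= ((c + eta) * Num.sqrt T%:R)%:E)%E.
Proof.
move=> eta0; pose b' := b + eta / 2.
have d0 : 0 < eps - 2 * gcdf_int (- b').
  have : gcdf_int (- b') < gcdf_int y by apply: gcdf_int_lt; rewrite /b' /b; lra.
  by move: psiy; lra.
have eta2 : 0 < eta / 2 by rewrite divr_gt0.
near=> T.
have T1 : (1 <= T)%N by near: T; exact: nbhs_infty_ge.
have HL : olo_const * (1 + ln T%:R) <= (eps - 2 * gcdf_int (- b')) * Num.sqrt T%:R.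
  by near: T; apply: near_log_le_sqrt => //; exact: olo_const_ge0.
have HR : olo_const * (1 + ln T%:R) <= eta / 2 * Num.sqrt T%:R.
  by near: T; apply: near_log_le_sqrt => //; exact: olo_const_ge0.
have s0 : 0 <= Num.sqrt (T%:R : R) by exact: sqrtr_ge0.
pose alg := stein_alg
  (two_hinges (b' * Num.sqrt T%:R) (2 * gcdf_int (- b') * Num.sqrt T%:R))
  (Num.sqrt (T%:R + 1)) (stein_rho T).
apply: (@le_trans _ _ (worst_Regret_unif T alg)).
  apply: ereal_inf_lbound; exists alg => //; split; first exact: stein_alg_range.
  apply: ge_ereal_sup => _ [adv badv <-]; rewrite lee_fin.
  by have [H _] := stein_alg_guarantee b' T adv T1 badv; lra.
apply: ge_ereal_sup => _ [adv badv <-]; rewrite lee_fin.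
have [_ H] := stein_alg_guarantee b' T adv T1 badv; apply: (le_trans H).
have : 2 * gcdf_int (- b') * Num.sqrt T%:R <= eps * Num.sqrt T%:R.
  by rewrite ler_wpM2r//; lra.
by move: HR; rewrite /c /b' /b; lra.
Unshelve. all: by end_near. Qed.

(** The greedy adversary is run with a kink [b'] slightly below [b], cut off at 0, so that the
    initial potential exceeds the allowed loss by a margin whenever [b' > 0]. *)
Lemma near_opt_Regret_ge eta : 0 < eta ->
  \forall T \near \oo, (((c - eta) * Num.sqrt T%:R)%:E <= opt_Regret_unif eps T)%E.
Proof.
move=> eta0; have eta2 : 0 < eta / 2 by rewrite divr_gt0.
pose b' : R := Num.max 0 (b - eta / 2).
have b'0 : 0 <= b' by rewrite le_max lexx.
have b'b : b' <= b by rewrite ge_max /b; move: y0; lra.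
have eb' : eps <= 2 * gcdf_int (- b').
  move: b'b; rewrite le_eqVlt => /predU1P[->|lt]; first by rewrite /b opprK psiy.
  have : gcdf_int y < gcdf_int (- b') by apply: gcdf_int_lt; move: lt; rewrite /b; lra.
  by move: psiy; lra.
(* Half the margin. For [b' = 0] the margin may be zero, and 1 is a positive placeholder. *)
pose d := if b' == 0 then 1 else (2 * gcdf_int (- b') - eps) / 2.
have d0 : 0 < d.
  rewrite /d; case: eqP => // /eqP bn0; rewrite divr_gt0// subr_gt0.
  have b'E : b' = b - eta / 2.
    by move: bn0; rewrite /b'; case: ltP => // _; rewrite eqxx.
  have : gcdf_int y < gcdf_int (- b') by apply: gcdf_int_lt; rewrite b'E /b; lra.
  by move: psiy; lra.
near=> T.
have T1 : (1 <= T)%N by near: T; exact: nbhs_infty_ge.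
have HL : olo_const * (1 + ln T%:R) <= d * Num.sqrt T%:R.
  by near: T; apply: near_log_le_sqrt => //; exact: olo_const_ge0.
have HR : olo_const * (1 + ln T%:R) <= eta / 2 * Num.sqrt T%:R.
  by near: T; apply: near_log_le_sqrt => //; exact: olo_const_ge0.
have s0 : 0 < Num.sqrt (T%:R : R) by rewrite sqrtr_gt0 ltr0n.
apply: le_ereal_inf_tmp => _ [alg [algok wL] <-].
set adv := greedy_adv (b' * Num.sqrt T%:R) T.
have badv : bounded_adv T alg adv by exact: greedy_adv_bounded.
have L : Loss T alg adv <= eps * Num.sqrt T%:R.
  rewrite -lee_fin; apply: le_trans wL; apply: ereal_sup_ubound.
  by exists adv.
have G := greedy_guarantee b' T alg b'0 T1; rewrite -/adv in G.
apply: (@le_trans _ _ (Regret_unif T alg adv)%:E); last first.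
  by apply: ereal_sup_ubound; exists adv.
rewrite lee_fin Regret_unifE.
set n := net _ in G *; set l := Loss _ _ _ in L G *.
have e's : eps * Num.sqrt T%:R <= 2 * gcdf_int (- b') * Num.sqrt T%:R.
  by rewrite ler_wpM2r// ltW.
have b's : (b - eta / 2) * Num.sqrt T%:R <= b' * Num.sqrt T%:R.
  by rewrite ler_wpM2r ?(ltW s0)// le_max lexx orbT.
have cE : (c - eta) * Num.sqrt T%:R = (b - eta / 2) * Num.sqrt T%:R
    + eps * Num.sqrt T%:R - eta / 2 * Num.sqrt T%:R by rewrite /c /b; field.
(* An active hinge gives the claim directly. An inactive one with [b' > 0] contradicts the loss
   constraint; with [b' = 0] it means that the total is 0, and the loss alone suffices. *)
rewrite cE; move: G; case: (leP (`|n| - b' * Num.sqrt T%:R) 0) => [nb|nb] G; last lra.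
have d0' := d0; move: HL d0'; rewrite /d; case: eqP => [b'00 _ _|_ HL' d0'].
  by move: nb b's G e's; rewrite b'00 !mul0r; have := normr_ge0 n; lra.
by have := mulr_gt0 d0' s0; lra.
Unshelve. all: by end_near. Qed.

End Eps.

End Asymptotics.

(** * The value of [gamma] and the final assembly *)

Section Gamma.
Context {R : realType}.
Implicit Types (eps y eta : R).

(** The two eventual bounds make the normalized optimum finite and convergent, so its limsup is its
    limit. *)
Lemma gammaE eps y : y <= 0 -> 2 * gcdf_int y = eps -> gamma eps = (eps - y)%:E.
Proof.
move=> y0 psiy; rewrite /gamma.
set u := fun T : nat => _; set c := eps - y.
have key eta : 0 < eta -> \forall T \near \oo,
    u T \is a fin_num /\ `|c - fine (u T)| <= eta.
  move=> eta0; near=> T.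
  have s0 : 0 < Num.sqrt (T%:R : R).
    by rewrite sqrtr_gt0 ltr0n; near: T; exact: nbhs_infty_ge.
  have : (opt_Regret_unif eps T <= ((c + eta) * Num.sqrt T%:R)%:E)%E.
    by near: T; exact: near_opt_Regret_le.
  have : (((c - eta) * Num.sqrt T%:R)%:E <= opt_Regret_unif eps T)%E.
    by near: T; exact: near_opt_Regret_ge.
  rewrite /u; case: (opt_Regret_unif eps T) => [r| |]//; rewrite !lee_fin => lo up.
  have lo' : c - eta <= (Num.sqrt T%:R)^-1 * r by rewrite mulrC ler_pdivlMr.
  have up' : (Num.sqrt T%:R)^-1 * r <= c + eta by rewrite mulrC ler_pdivrMr.
  by split=> //=; rewrite distrC ler_norml; lra.
apply: (cvg_limn_einf_sup _).2; apply/fine_cvgP; split.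
  by have := key 1 ltr01; apply: filterS => T [].
by apply/cvgrPdist_le => e e0; have := key e e0; apply: filterS => T [].
Unshelve. all: by end_near. Qed.

End Gamma.

Theorem theorem5 (R : realType) :
  exists C : R, forall eps : R, 0 < eps -> eps <= Num.sqrt (2 / pi) ->
  exists c : R,
    [/\ gamma eps = c%:E,
        unique (gamma_equation eps) c &
        forall T : nat, (1 <= T)%N ->
          exists (h : R -> R) (rho0 : R) (rho : seq R -> R),
            [/\ convex_function setT h,
                1.-lipschitz h,
                admissible T rho0 rho,
                is_olo_alg T (stein_alg h rho0 rho) &
                forall adv : seq R -> R,
                  bounded_adv T (stein_alg h rho0 rho) adv ->
                  Loss T (stein_alg h rho0 rho) adv
                    <= eps * Num.sqrt T%:R + C * (1 + ln T%:R) /\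
                  Regret_unif T (stein_alg h rho0 rho) adv
                    <= c * Num.sqrt T%:R + C * (1 + ln T%:R)]].
Proof.
exists olo_const => eps eps0 eps1.
(* The root [y] is [eps] minus the value of [gamma], and the kink of the potential is placed at
   [- y * sqrt T]. *)
have [y y0 psiy] := gcdf_int_surj _ eps0 eps1.
exists (eps - y); split; first exact: gammaE.
  split; first by apply/gamma_equationE; rewrite subKr.
  move=> c /gamma_equationE E.
  suff -> : y = eps - c by rewrite subKr.
  apply: gcdf_int_inj; apply: (@mulfI _ 2) => //.
  by rewrite psiy E.
move=> T T1.
exists (two_hinges (- y * Num.sqrt T%:R) (2 * gcdf_int (- - y) * Num.sqrt T%:R)).
exists (Num.sqrt (T%:R + 1)), (stein_rho T); split.
- exact: two_hinges_convex.
- by apply: two_hinges_lipschitz; rewrite mulr_ge0// oppr_ge0.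
- exact: stein_rho_admissible.
- exact: stein_alg_range.
- move=> adv /(stein_alg_guarantee (- y) _ _ T1).
  by rewrite opprK psiy [- y + eps]addrC.
Qed.
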